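(* Let $G=(V,E)$ be a planar graph with a fixed planar embedding, let $A$ be a node assignment of $G$ and let $f$ be a face of $G$. Then $A$ is realizable for $f$ if and only if $A$ satisfies the parity condition and the matching condition for $f$.
   Context: Let $F$ be the set of faces of the fixed embedding of $G$. For $i\in\{0,1,2\}$ let $V^i$ be the set of vertices of degree $i$ in $G$, and $\bar V=V^0\cup V^1\cup V^2$; a vertex $v\in\bar V$ has $3-\deg_G(v)$ free valencies. A node assignment is a map $A:\bar V\to F$ such that each $v$ is incident to the face $A(v)$. For a face $f$, $V_f=A^{-1}(f)$ is the set of vertices assigned to $f$; the free valencies of vertices in $V_f$ are said to be assigned to $f$. $A$ is realizable for $f$ if there is a set $W_f\subseteq\binom{V_f}{2}$ of non-edges of $G$ such that every vertex of $V_f$ has degree 3 in $(V,E\cup W_f)$. Parity condition for $f$: $\sum_{v\in V_f}(3-\deg_G(v))$ is even. Matching condition for $f$: every indicator set for $f$ is satisfied, where the indicator sets $S\subseteq V_f$ (all degrees taken in $G$) and their requirements on the free valencies of vertices in $V_f\setminus S$ are: (1) joker: $S=\{v\}$, $v\in V^2$ with no neighbour in $V_f$; requires at least one free valency in $V_f\setminus S$. (2) pair: $S=\{u,v\}\subseteq V^2$ with $u,v$ adjacent; requires at least two free valencies in $V_f\setminus S$. (3) leaf: $S=\{v\}$, $v\in V^1$ whose neighbour has degree 3; requires at least two distinct vertices of $V_f\setminus S$ with free valencies. (4) branch: $S=\{u,r\}$ with $u\in V^1$, $r\in V^2$, $u,r$ adjacent; requires that one can choose three free valencies of vertices of $V_f\setminus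 S$ (a vertex $w$ contributing at most $3-\deg_G(w)$ of them) belonging to at least two distinct vertices, of which at most one belongs to a vertex adjacent to $r$. (5) island: $S=\{v\}$, $v\in V^0$; requires at least three distinct vertices of $V_f\setminus S$ with free valencies. (6) stick: $S=\{u,v\}\subseteq V^1$ with $u,v$ adjacent; requires $\sum_{w\in V_f\setminus S}\min\{2,3-\deg_G(w)\}\ge 4$. (7) $S=\{u,v\}\subseteq V^0$; same requirement as (6). (8) 3-cycle: $S$ consists of three vertices of $V^2$ forming a cycle of $G$; requires at least three free valencies in $V_f\setminus S$.
   Formalization: The graph is assumed to have maximum degree at most 3 (the cubic-augmentation setting); without this the claim fails, e.g. for K4 with a leaf attached to one vertex, where the leaf is alone in its face and no indicator set applies. *)

(* Defs.v *)
From HB Require Import structures.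
From mathcomp Require Import all_boot all_order all_algebra.
From mathcomp Require Import all_classical all_reals all_analysis.

Set Implicit Arguments.
Unset Strict Implicit.
Unset Printing Implicit Defensive.

Import Order.TTheory GRing.Theory Num.Theory.
Import numFieldNormedType.Exports.

Local Open Scope classical_set_scope.
Local Open Scope ring_scope.

Section Graphs.
Variable V : finType.
Implicit Types (E W : {set {set V}}) (U S : {set V}) (u v w r : V).

(* A finite simple graph is (V, E) with E a set of 2-element subsets of V. *)
Definition simple_graph E : Prop := forall e, e \in E -> #|e| = 2%N.

Definition adj E u v : bool := [set u; v]%SET \in E.

Definition deg E v : nat := #|[set e in E | v \in e]%SET|.

Definition Vdeg E (i : nat) : {set V} := [set v | deg E v == i]%SET.

(* The set of vertices that have free valencies. *)
Definition Vbar E : {set V} := (Vdeg E 0 :|: Vdeg E 1 :|: Vdeg E 2)%SET.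

Definition free_val E v : nat := (3 - deg E v)%N.

Section Conditions.
(* U is the set V_f of vertices assigned to the face under consideration. *)
Variables (E : {set {set V}}) (U : {set V}).

Definition realizable_set : Prop :=
  exists W : {set {set V}},
    [/\ forall e, e \in W -> e \subset U /\ #|e| = 2%N,
        forall e, e \in W -> e \notin E &
        forall v, v \in U -> deg (E :|: W)%SET v = 3%N].

Definition parity_condition : Prop := ~~ odd (\sum_(v in U) free_val E v)%N.

Definition free_in S : nat := (\sum_(w in S) free_val E w)%N.

Definition free_vertices S : nat := #|[set w in S | (0 < free_val E w)%N]%SET|.

Definition joker_condition : Prop :=
  forall v, v \in U -> v \in Vdeg E 2 ->
    (forall w, w \in U -> ~~ adj E v w) ->
  (1 <= free_in (U :\: [set v])%SET)%N.

Definition pair_condition : Prop :=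
  forall u v, u \in U -> v \in U -> u \in Vdeg E 2 -> v \in Vdeg E 2 ->
    adj E u v ->
  (2 <= free_in (U :\: [set u; v])%SET)%N.

Definition leaf_condition : Prop :=
  forall v, v \in U -> v \in Vdeg E 1 ->
    (exists2 w, adj E v w & deg E w = 3%N) ->
  (2 <= free_vertices (U :\: [set v])%SET)%N.

(* k w is the number of chosen free valencies that belong to w. *)
Definition branch_condition : Prop :=
  forall u r, u \in U -> r \in U -> u \in Vdeg E 1 -> r \in Vdeg E 2 ->
    adj E u r ->
  let S := (U :\: [set u; r])%SET in
  exists k : V -> nat,
    [/\ forall w, w \in S -> (k w <= free_val E w)%N,
        (\sum_(w in S) k w = 3)%N,
        (2 <= #|[set w in S | (0 < k w)%N]%SET|)%N &
        (\sum_(w in S | adj E r w) k w <= 1)%N].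

Definition island_condition : Prop :=
  forall v, v \in U -> v \in Vdeg E 0 ->
  (3 <= free_vertices (U :\: [set v])%SET)%N.

Definition stick_condition : Prop :=
  forall u v, u \in U -> v \in U -> u \in Vdeg E 1 -> v \in Vdeg E 1 ->
    adj E u v ->
  (4 <= \sum_(w in (U :\: [set u; v])%SET) minn 2 (free_val E w))%N.

Definition two_islands_condition : Prop :=
  forall u v, u \in U -> v \in U -> u \in Vdeg E 0 -> v \in Vdeg E 0 ->
    u != v ->
  (4 <= \sum_(w in (U :\: [set u; v])%SET) minn 2 (free_val E w))%N.

Definition three_cycle_condition : Prop :=
  forall u v w, u \in U -> v \in U -> w \in U ->
    u \in Vdeg E 2 -> v \in Vdeg E 2 -> w \in Vdeg E 2 ->
    adj E u v -> adj E v w -> adj E w u ->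
  (3 <= free_in (U :\: [set u; v; w])%SET)%N.

Definition matching_condition : Prop :=
  (joker_condition /\ pair_condition /\ leaf_condition /\ branch_condition) /\
  (island_condition /\ stick_condition /\ two_islands_condition /\
   three_cycle_condition).

End Conditions.
End Graphs.

Section Embeddings.
Variables (R : realType) (V : finType) (E : {set {set V}}).

Local Notation plane := (R * R)%type.

(* A crossing-free drawing of (V, E) in the plane: the vertices are distinct
   points, and every edge e is a simple curve pe_curve e, parametrized by
   [0, 1], that joins its two end vertices, has no vertex in its interior, and
   has no interior point in common with another edge. *)
Record planar_embedding := PlanarEmbedding {
  pe_pos : V -> plane ;
  pe_curve : {set V} -> R -> plane ;
  pe_pos_inj : injective pe_pos ;
  pe_curve_continuous : forall e, e \in E ->
    {within `[0, 1], continuous (pe_curve e)} ;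
  pe_curve_inj : forall e, e \in E ->
    {in `[0, 1]%R &, injective (pe_curve e)} ;
  pe_curve_ends : forall e, e \in E ->
    exists u v : V, [/\ e = [set u; v]%SET,
      pe_curve e 0 = pe_pos u & pe_curve e 1 = pe_pos v] ;
  pe_curve_vertex : forall e, e \in E ->
    forall t : R, 0 < t < 1 -> forall w : V, pe_curve e t != pe_pos w ;
  pe_curve_disjoint : forall e e', e \in E -> e' \in E -> e != e' ->
    forall s t : R, 0 < s < 1 -> 0 < t < 1 -> pe_curve e s != pe_curve e' t
}.

Variable G : planar_embedding.

Definition drawing : set plane :=
  range (pe_pos G) `|`
  \bigcup_(e in [set e : {set V} | e \in E]) (pe_curve G e @` `[0, 1]).

(* The faces are the connected components of the complement of the drawing. *)
Definition is_face (f : set plane) : Prop :=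
  exists2 x, (~` drawing) x & f = connected_component (~` drawing) x.

(* A vertex is never a point of a face, so it lies in the closure of f exactly
   when it lies on the boundary of f. *)
Definition incident (v : V) (f : set plane) : Prop :=
  closure f (pe_pos G v).

(* Only the restriction of A to Vbar E is meaningful. *)
Definition node_assignment (A : V -> set plane) : Prop :=
  forall v, v \in Vbar E -> is_face (A v) /\ incident v (A v).

Definition assigned (A : V -> set plane) (f : set plane)
  : {set V} := [set v in Vbar E | `[< A v = f >]]%SET.

Definition realizable_for A f : Prop := realizable_set E (assigned A f).

Definition satisfies_parity A f : Prop := parity_condition E (assigned A f).

Definition satisfies_matching A f : Prop := matching_condition E (assigned A f).

End Embeddings.

(* Main.v *)
Require Import Defs.
From mathcomp Require Import all_boot all_order all_algebra.
From mathcomp Require Import all_classical all_reals all_analysis.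
From mathcomp Require Import ring lra zify.

(** Only one fact about the embedding matters: the neighbour w of a leaf v, if
    it has degree at most 2, is incident to no other face than v.  Hence every
    leaf assigned to f either has a neighbour of degree 3 or has its neighbour
    assigned to f, and the rest concerns the graph induced on V_f alone.

    To see the fact, remove from the drawing the edge vw and half of the second
    edge at w, if there is one.  Points near v and near w are then not separated
    by what remains, and putting back an arc that meets a closed set at most in
    its first point never separates two points.  The latter is proved by
    continuous induction along the arc from Janiszewski's theorem: if A and B
    are closed with at most one common point c and neither separates p from q,
    then neither does their union.  An inversion at c reduces this to disjoint
    A and B, where a separation would give a map to the circle R/Z whose lift to
    the plane jumps by 1 between p and q.

    For the combinatorial part put n = #|V_f|.  If n >= 5, parity implies the
    matching condition, and parity alone suffices for realizability: as long as
    at least 5 vertices with free valencies remain after adding a non-edge, add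
    it and use induction; the only other cases are n = 5, and n = 6 with a single
    free valency at each vertex.  These, and the equivalence for n <= 4, are
    finite checks done by computation. *)

Set Implicit Arguments.
Unset Strict Implicit.
Unset Printing Implicit Defensive.

Import Order.TTheory GRing.Theory Num.Theory numFieldNormedType.Exports.

(** * Separation in the plane *)

Section Joined.
Local Open Scope classical_set_scope.
Local Open Scope ring_scope.

(* Compactness provides a positive distance to a disjoint closed set, and
   bounds the region of the plane on which a map has to be lifted. *)
Definition joined (T : topologicalType) (X : set T) (p q : T) : Prop :=
  exists C : set T, [/\ compact C, connected C, C `<=` X, C p & C q].

Lemma joined_sub (T : topologicalType) (X Y : set T) p q :
  X `<=` Y -> joined X p q -> joined Y p q.
Proof.
move=> XY [C [cC coC CX Cp Cq]]; exists C; split=> //.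
exact: subset_trans XY.
Qed.

Lemma joined_sym (T : topologicalType) (X : set T) p q :
  joined X p q -> joined X q p.
Proof. by move=> [C [? ? ? ? ?]]; exists C. Qed.

Lemma joined_trans (T : topologicalType) (X : set T) q p r :
  joined X p q -> joined X q r -> joined X p r.
Proof.
move=> [C [cC coC CX Cp Cq]] [D [cD coD DX Dq Dr]]; exists (C `|` D); split.
- exact: compactU.
- by apply: connectedU => //; exists q.
- by rewrite subUset.
- by left.
- by right.
Qed.

Lemma joined_image (T U : topologicalType) (f : T -> U) (X : set T) (Y : set U)
    p q :
  (forall x, X x -> {for x, continuous f}) -> (forall x, X x -> Y (f x)) ->
  joined X p q -> joined Y (f p) (f q).
Proof.
move=> cf XY [C [cC coC CX Cp Cq]]; exists (f @` C).
have cfC : {within C, continuous f}.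
  by apply: continuous_in_subspaceT => x /set_mem /CX /cf.
split; [exact: continuous_compact|exact: connected_continuous_connected| | |].
- by move=> _ [x /CX /XY Yfx <-].
- by exists p.
- by exists q.
Qed.

Lemma joined_component (T : topologicalType) (X : set T) p q :
  joined X p q -> connected_component X p q.
Proof. by move=> [C [? ? ? Cp Cq]]; exists C => //; split. Qed.

Variable R : realType.

Lemma joined_path (T : topologicalType) (X : set T) (g : R -> T) (a b : R) :
  continuous g -> a <= b -> (forall t, a <= t <= b -> X (g t)) ->
  joined X (g a) (g b).
Proof.
move=> cg ab gX; apply: (@joined_image _ _ g `[a, b]%classic).
- by move=> x _; apply: cg.
- by move=> x /=; rewrite in_itv /=; apply: gX.
- exists `[a, b]%classic; split => //.
  + exact: segment_compact.
  + exact: segment_connected.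
  + by rewrite /= in_itv /= lexx ab.
  + by rewrite /= in_itv /= lexx ab.
Qed.

Lemma joined_segment (T : normedModType R) (X : set T) p q :
  (forall t : R, 0 <= t <= 1 -> X (p + t *: (q - p))) -> joined X p q.
Proof.
move=> h; pose g (t : R) : T := p + t *: (q - p).
have -> : p = g 0 by rewrite /g scale0r addr0.
have -> : q = g 1 by rewrite /g scale1r addrC subrK.
apply: joined_path; [|exact: ler01|exact: h].
move=> t; apply: cvgD; first exact: cvg_cst.
by apply: cvgZr_tmp; exact: cvg_id.
Qed.

Lemma joined_ball (T : normedModType R) (X : set T) x e p q :
  ball x e `<=` X -> ball x e p -> ball x e q -> joined X p q.
Proof.
move=> bX bp bq; apply: joined_segment => t /andP[t0 t1]; apply: bX.
move: bp bq; rewrite -!ball_normE /ball_ /= => bp bq.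
have -> : x - (p + t *: (q - p)) = (1 - t) *: (x - p) + t *: (x - q).
  rewrite scalerBl scale1r -addrA [X in _ = _ + X]addrC -scalerBr.
  have -> : x - q - (x - p) = p - q by rewrite opprB addrC addrA subrK.
  by rewrite opprD addrA -scalerN opprB.
rewrite (le_lt_trans (ler_normD _ _))// !normrZ ger0_norm ?subr_ge0// ger0_norm//.
have h1 : 0 <= (1 - t) * (e - `|x - p|) by rewrite mulr_ge0 ?subr_ge0// ltW.
have [->|tN0] := eqVneq t 0; first by rewrite subr0 mul1r mul0r addr0.
have h2 : 0 < t * (e - `|x - q|) by rewrite mulr_gt0 ?subr_gt0// lt_neqAle eq_sym tN0.
lra.
Qed.

(** The image of [C] is an interval consisting of integers; between two different ones it would also
    contain a half-integer. *)
Lemma connected_int_valued (T : topologicalType) (F : T -> R) (C : set T) p q :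
  connected C -> {within C, continuous F} ->
  (forall x, C x -> exists k : int, F x = k%:~R) -> C p -> C q -> F p = F q.
Proof.
move=> coC cF FZ.
have /connected_intervalP itv := connected_continuous_connected coC cF.
have key x y : C x -> C y -> ~ (F x < F y).
  move=> Cx Cy xy; have [k Fx] := FZ _ Cx; have [l Fy] := FZ _ Cy.
  have kl : k%:~R + 1 <= l%:~R :> R.
    by move: xy; rewrite Fx Fy ltr_int -lezD1 -(ler_int R) intrD.
  have Fxyz : F x <= F x + 2^-1 <= F y by rewrite Fx Fy; lra.
  have [z Cz Fz] := itv _ _ (imageP F Cx) (imageP F Cy) _ Fxyz.
  have [m] := FZ _ Cz; rewrite Fz Fx => e.
  have h1 : k%:~R < m%:~R :> R by rewrite -e; lra.
  have h2 : m%:~R < (k + 1)%:~R :> R by rewrite -e intrD; lra.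
  by move: h1 h2; rewrite !ltr_int => h1; rewrite ltzD1 leNgt h1.
move=> Cp Cq; have /negP := key _ _ Cp Cq; have /negP := key _ _ Cq Cp.
by rewrite -!leNgt => h1 h2; apply/eqP; rewrite eq_le h1 h2.
Qed.

End Joined.

(** * Lifting maps from the plane to the circle R/Z *)

Section Lifting.
Local Open Scope classical_set_scope.
Local Open Scope ring_scope.
Variable R : realType.

Definition int_near (e t : R) : Prop := exists k : int, `|t - k%:~R| < e.

(** The function [g] represents a map to R/Z: it may jump, but only by amounts close to integers. *)
Definition continuous_mod1 (T : topologicalType) (g : T -> R) : Prop :=
  forall x e, 0 < e -> \forall y \near x, int_near e (g y - g x).

Definition has_lift (T : topologicalType) (g : T -> R) : Prop :=
  exists2 th : T -> R, continuous th & forall x, exists k : int, th x = g x + k%:~R.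

Lemma int_nearB (e1 e2 s t : R) :
  int_near e1 s -> int_near e2 t -> int_near (e1 + e2) (s - t).
Proof.
move=> [k hk] [l hl]; exists (k - l); rewrite intrB.
have -> : s - t - (k%:~R - l%:~R) = (s - k%:~R) - (t - l%:~R) by ring.
by rewrite (le_lt_trans (ler_normB _ _))// ltrD.
Qed.

Lemma continuous_mod1B (T : topologicalType) (g h : T -> R) :
  continuous_mod1 g -> continuous_mod1 h -> continuous_mod1 (fun x => g x - h x).
Proof.
move=> cg ch x e e0; have e20 : 0 < e / 2 by lra.
near=> y.
have -> : g y - h y - (g x - h x) = (g y - g x) - (h y - h x) by ring.
have -> : e = e / 2 + e / 2 by lra.
by apply: int_nearB; near: y; [apply: cg|apply: ch].
Unshelve. all: by end_near. Qed.

Lemma continuous_mod1_comp (S T : topologicalType) (f : S -> T) (g : T -> R) :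
  continuous f -> continuous_mod1 g -> continuous_mod1 (g \o f).
Proof. by move=> cf cg x e e0; apply: (cf x _ (cg (f x) e e0)). Qed.

(** Subtracting a nearby integer [k x] gives the lift. With tolerance 1/4 the choice is consistent:
    if [h y - h x] is within 1/4 of m, then [k y - k x] differs from m by less than 3/4, hence
    equals m. *)
Lemma has_lift_near_int (T : topologicalType) (h : T -> R) :
  continuous_mod1 h -> (forall x, int_near 4^-1 (h x)) -> has_lift h.
Proof.
move=> ch /choice[k hk]; exists (fun x => h x + (- k x)%:~R); last first.
  by move=> x; exists (- k x).
move=> x; apply/cvgrPdist_lt => e e0.
have e'0 : 0 < Num.min e 4^-1 by rewrite lt_min e0 invr_gt0 ltr0n.
near=> y.
have [m hm] : int_near (Num.min e 4^-1) (h y - h x) by near: y; apply: ch.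
move: hm; rewrite lt_min => /andP[hm1 hm2].
suff -> : h x + (- k x)%:~R - (h y + (- k y)%:~R) = - (h y - h x - m%:~R).
  by rewrite normrN.
have hx := hk x; have hy := hk y.
have : k y - k x = m.
  have lt1 : `|(k y - k x - m)%:~R : R| < 1.
    move: hx hy hm2; rewrite !intrB !ltr_norml => /andP[? ?] /andP[? ?] /andP[? ?].
    by apply/andP; split; lra.
  move: lt1; rewrite -intr_norm -[1]/(1%:~R) ltr_int; lia.
move=> <-; rewrite !intrN intrB; ring.
Unshelve. all: by end_near. Qed.

(** The difference [h - g] stays near the integers and so lifts by itself; its lift is added to that
    of [g]. *)
Lemma has_lift_step (T : topologicalType) (g h : T -> R) :
  continuous_mod1 g -> continuous_mod1 h ->
  (forall x, int_near 4^-1 (h x - g x)) -> has_lift g -> has_lift h.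
Proof.
move=> cg ch gh [th cth hth].
have [rho crho hrho] := has_lift_near_int (continuous_mod1B ch cg) gh.
exists (fun x => th x + rho x).
  by move=> x; apply: cvgD; [exact: cth|exact: crho].
move=> x; have [k ->] := hth x; have [l ->] := hrho x.
exists (k + l); rewrite intrD; ring.
Qed.

(** The Heine-Cantor argument modulo 1, with tolerance 1/8 and half the radius around each centre.
    Only the first of the two points has to lie in [D]. *)
Lemma continuous_mod1_uniform (T : normedModType R) (g : T -> R) (D : set T) :
  compact D -> continuous_mod1 g ->
  exists2 d : R, 0 < d &
    forall x y, D x -> `|x - y| < d -> int_near 4^-1 (g y - g x).
Proof.
move=> /compact_near_coveringP cD cg.
pose P d x := forall y, `|x - y| < d -> int_near 4^-1 (g y - g x).
have [d /= d0 hd] : \forall d \near (0 : R)^'+, D `<=` P d.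
  apply: cD.
  move=> x Dx.
  have /nbhs_ballP[e /= e0 he] : \forall y \near x, int_near 8^-1 (g y - g x).
    by apply: cg; rewrite invr_gt0.
  exists (ball x (e / 2), [set d | d < e / 2]) => /=.
    split; first by apply: nbhsx_ballx; rewrite divr_gt0.
    by apply: nbhs_right_lt; rewrite divr_gt0.
  move=> [z d] /= [xz de] y zy.
  have -> : g y - g z = (g y - g x) - (g z - g x) by ring.
  have -> : 4^-1 = 8^-1 + 8^-1 :> R by lra.
  move: xz; rewrite -ball_normE /= => xz.
  apply: int_nearB; apply: he; rewrite -ball_normE /=; last by lra.
  have -> : x - y = (x - z) + (z - y) by rewrite addrA subrK.
  by rewrite (le_lt_trans (ler_normD _ _))//; lra.
exists (d / 2); first by rewrite divr_gt0.
move=> x y Dx xy; apply: (hd (d / 2)) => //=.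
  by rewrite sub0r normrN gtr0_norm; lra.
by rewrite divr_gt0.
Qed.

Lemma bounded_plane_lift (g : R * R -> R) (N : R) :
  0 < N -> continuous_mod1 g ->
  exists2 th : R * R -> R, continuous th &
    forall x, `|x| <= N -> exists k : int, th x = g x + k%:~R.
Proof.
move=> N0 cg.
pose D : set (R * R) := `[- N, N]%classic `*` `[- N, N]%classic.
have DE x : `|x| <= N -> D x.
  rewrite prod_normE ge_max => /andP[]; rewrite !ler_norml => h1 h2.
  by split; rewrite /= in_itv.
have cD : compact D by apply: compact_setX; exact: segment_compact.
have [d d0 hd] := continuous_mod1_uniform cD cg.
(* The radial retraction of the plane onto the ball of radius [N]. *)
pose cl (x : R * R) : R * R := (N / Num.max N `|x|) *: x.
have m0 (x : R * R) : 0 < Num.max N `|x| by rewrite lt_max N0.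
have ccl : continuous cl.
  move=> x; apply: cvgZ; last exact: cvg_id.
  apply: cvgM; first exact: cvg_cst.
  apply: cvgV; first by rewrite gt_eqF.
  apply: continuous_max; first exact: cvg_cst.
  exact: norm_continuous.
have cl_le x : `|cl x| <= N.
  rewrite normrZ gtr0_norm ?divr_gt0// mulrAC ler_pdivrMr//.
  by rewrite ler_pM2l// le_max lexx orbT.
have cl_id x : `|x| <= N -> cl x = x.
  by move=> xN; rewrite /cl (max_idPl xN) divff ?scale1r// gt_eqF.
(* Scaling a point of the ball by (k+1)/(n+1) instead of k/(n+1) moves it by at most N/(n+1), which
   is to be less than [d]. *)
have [n hn] : exists n : nat, N < d * n.+1%:R.
  exists (Num.truncn (N / d)); rewrite -ltr_pdivrMl// mulrC.
  exact: truncnS_gt.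
(* The homotopy [s, x |-> g (s *: cl x)] is lifted in n.+1 small steps. *)
pose G k := g \o (fun x => (k%:R / n.+1%:R) *: cl x).
have cG k : continuous_mod1 (G k).
  apply: continuous_mod1_comp => // x; apply: cvgZl_tmp; exact: ccl.
have n0 : (0 : R) < n.+1%:R by rewrite ltr0n.
have GS k x : (k < n.+1)%N -> int_near 4^-1 (G k.+1 x - G k x).
  move=> kn; apply: hd.
    apply: DE; rewrite normrZ ger0_norm ?divr_ge0// mulrAC ler_pdivrMr//.
    by rewrite mulrC ler_pM// ler_nat ltnW.
  rewrite -scalerBl -mulrBl -natr1 opprD addrA subrr add0r mulN1r normrZ.
  rewrite normrN normfV ger0_norm// mulrC ltr_pdivrMr//.
  by rewrite (le_lt_trans (cl_le x)).
have lift k : (k <= n.+1)%N -> has_lift (G k).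
  elim: k => [_|k IH kn].
    exists (fun=> g 0); first by move=> x; exact: cvg_cst.
    by move=> x; exists 0; rewrite /G /= mul0r scale0r addr0.
  by apply: has_lift_step (IH (ltnW kn)) => // x; exact: GS.
have [th cth hth] := lift _ (leqnn _).
exists th => // x xN; have [k ->] := hth x; exists k.
by rewrite /G /= divff ?gt_eqF// scale1r cl_id.
Qed.

End Lifting.

(** * Janiszewski's theorem for disjoint closed sets *)

Section Janiszewski.
Local Open Scope classical_set_scope.
Local Open Scope ring_scope.
Variable R : realType.

Lemma joined_open (T : normedModType R) (X : set T) p :
  open X -> open [set x | joined X p x].
Proof.
move=> oX; rewrite openE => x /= pX.
have Xx : X x by case: pX => C [_ _ CX _ /CX].
have /nbhs_ballP[e e0 he] : nbhs x X by apply: open_nbhs_nbhs.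
apply/nbhs_ballP; exists e => // y xy /=.
by apply: (joined_trans pX); apply: (joined_ball he) => //; exact: ballxx.
Qed.

Lemma not_joined_open (T : normedModType R) (X : set T) p :
  open X -> open (X `&` [set x | ~ joined X p x]).
Proof.
move=> oX; rewrite openE => x /= [Xx pX].
have /nbhs_ballP[e e0 he] : nbhs x X by apply: open_nbhs_nbhs.
apply/nbhs_ballP; exists e => // y xy /=; split; first exact: he.
move=> py; apply: pX; apply: (joined_trans py).
by apply: (joined_ball he) => //; exact: ballxx.
Qed.

Lemma janiszewski_disjoint (A B : set (R * R)) p q :
  closed A -> closed B -> A `&` B = set0 ->
  joined (~` A) p q -> joined (~` B) p q -> joined (~` (A `|` B)) p q.
Proof.
move=> clA clB AB0 jA jB; apply: contrapT => npq.
(* A Urysohn function with value 0 on [A] and 1 on [B]. Since both values are integers, replacing it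
   by 0 outside the region [Q] not joined to [p] keeps it continuous modulo 1. *)
have [phi [cphi phiA phiB _]] :=
  urysohn_ext_itv pseudometric_normal clA clB AB0 (@ltr01 R).
have {}phiA x : A x -> phi x = 0 by move=> Ax; apply: phiA; exists x.
have {}phiB x : B x -> phi x = 1 by move=> Bx; apply: phiB; exists x.
set X := ~` (A `|` B) in npq.
have oX : open X by apply: closed_openC; exact: closedU.
pose P := [set x | joined X p x]; pose Q := X `&` [set x | ~ joined X p x].
have oP : open P by exact: joined_open.
have oQ : open Q by exact: not_joined_open.
(* [piece 0] is continuous mod 1, hence has a lift.  As a real function it is
   continuous off B, and [piece 1], which differs from it by integers, is
   continuous off A; so the lift minus [piece 0] (resp. [piece 1]) takes the same
   value at p and q. *)
pose piece (c : R) x := if `[< Q x >] then phi x - c else 0.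
have pieceQ c x : Q x -> \forall y \near x, piece c y = phi y - c.
  move=> Qx; have : nbhs x Q by exact: open_nbhs_nbhs.
  by apply: filterS => y Qy; rewrite /piece asboolT.
have pieceP c x : P x -> \forall y \near x, piece c y = 0.
  move=> Px; have : nbhs x P by exact: open_nbhs_nbhs.
  by apply: filterS => y Py; rewrite /piece asboolF// => -[].
have cases x : [\/ P x, Q x, A x | B x].
  have [Ax|nAx] := pselect (A x); first by constructor 3.
  have [Bx|nBx] := pselect (B x); first by constructor 4.
  have [Px|nPx] := pselect (P x); first by constructor 1.
  by constructor 2; split => // -[].
have nQA x : A x -> ~ Q x by move=> Ax [nAB _]; apply: nAB; left.
have nQB x : B x -> ~ Q x by move=> Bx [nAB _]; apply: nAB; right.
have piece_cont c x : [\/ P x, Q x | ~ Q x /\ phi x = c] ->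
    {for x, continuous (piece c)}.
  move=> h; apply/cvgrPdist_lt => e e0; case: h => [Px|Qx|[nQx phix]].
  - have := pieceP c x Px; have := nbhs_singleton (pieceP c x Px) => ->.
    by apply: filterS => y ->; rewrite subrr normr0.
  - have := nbhs_singleton (pieceQ c x Qx) => ->.
    have /cvgrPdist_lt /(_ _ e0) := cphi x; apply: filterS2 (pieceQ c x Qx) => y ->.
    by rewrite opprB addrA subrK.
  - have -> : piece c x = 0 by rewrite /piece asboolF.
    have /cvgrPdist_lt /(_ _ e0) := cphi x; apply: filterS => y.
    rewrite phix sub0r normrN /piece; case: asboolP => _; last by rewrite normr0.
    by rewrite distrC.
have cg : continuous_mod1 (piece 0).
  move=> x e e0.
  have small : {for x, continuous (piece 0)} ->
      \forall y \near x, int_near e (piece 0 y - piece 0 x).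
    move=> /cvgrPdist_lt /(_ _ e0); apply: filterS => y; rewrite distrC => xy.
    by exists 0; rewrite subr0.
  have [Px|Qx|Ax|Bx] := cases x.
  - by apply/small/piece_cont; constructor 1.
  - by apply/small/piece_cont; constructor 2.
  - by apply/small/piece_cont; constructor 3; split; [exact: nQA|exact: phiA].
  have -> : piece 0 x = 0 by rewrite /piece asboolF//; exact: nQB.
  have /cvgrPdist_lt /(_ _ e0) := cphi x; apply: filterS => y.
  rewrite phiB// /piece; case: asboolP => _ h.
    by exists 1; rewrite !subr0 distrC.
  by exists 0; rewrite !subr0 normr0.
case: jA => C1 [cC1 coC1 C1A C1p C1q]; case: jB => C2 [cC2 coC2 C2B C2p C2q].
have [N N0 hN] : exists2 N : R, 0 < N & forall x, (C1 `|` C2) x -> `|x| <= N.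
  have [M [_ hM]] := compact_bounded (compactU cC1 cC2).
  exists (Num.max 1 (M + 1)); first by rewrite lt_max ltr01.
  by apply: hM; rewrite lt_max; apply/orP; right; rewrite ltrDl.
have [th cth hth] := bounded_plane_lift N0 cg.
have F_int c x : (C1 `|` C2) x ->
    exists k : int, th x - piece c%:~R x = k%:~R.
  move=> /hN /hth[k ->]; rewrite /piece; case: asboolP => _.
    by exists (k + c); rewrite intrD; ring.
  by exists k; ring.
have Xp : X p by move=> [/(C1A _ C1p)|/(C2B _ C2p)].
have Xq : X q by move=> [/(C1A _ C1q)|/(C2B _ C2q)].
have Pp : P p.
  by apply: joined_segment => t _; rewrite subrr scaler0 addr0.
have Qq : Q q by [].
have pc c := nbhs_singleton (pieceP c p Pp).
have qc c := nbhs_singleton (pieceQ c q Qq).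
have F1 : th p - piece 1%:~R p = th q - piece 1%:~R q.
  apply: (connected_int_valued (F := fun x => th x - piece 1%:~R x) coC1) => //.
    apply: continuous_in_subspaceT => x /set_mem C1x.
    apply: cvgB; first exact: cth.
    apply: piece_cont; case: (cases x) => [?|?|/(C1A _ C1x)//|Bx].
    - by constructor 1.
    - by constructor 2.
    - by constructor 3; split; [exact: nQB|exact: phiB].
  by move=> x C1x; apply: F_int; left.
have F0 : th p - piece 0%:~R p = th q - piece 0%:~R q.
  apply: (connected_int_valued (F := fun x => th x - piece 0%:~R x) coC2) => //.
    apply: continuous_in_subspaceT => x /set_mem C2x.
    apply: cvgB; first exact: cth.
    apply: piece_cont; case: (cases x) => [?|?|Ax|/(C2B _ C2x)//].
    - by constructor 1.
    - by constructor 2.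
    - by constructor 3; split; [exact: nQA|exact: phiA].
  by move=> x C2x; apply: F_int; right.
(* As [piece c] is 0 at [p] and [phi q - c] at [q], the difference [th q - th p] would be both
   [phi q] and [phi q - 1]. *)
move: F0 F1; rewrite !pc !qc; lra.
Qed.

End Janiszewski.

(** * Inversion in the unit sphere *)

Section Inversion.
Local Open Scope classical_set_scope.
Local Open Scope ring_scope.
Variables (R : realType) (T : normedModType R).

(** At 0 the value is 0, which makes the map an involution of the whole space; its continuity is
    claimed only at the other points. *)
Definition inversion (x : T) : T := (`|x| ^- 2) *: x.

Lemma norm_inversion x : `|inversion x| = `|x|^-1.
Proof.
have [->|x0] := eqVneq x 0; first by rewrite /inversion scaler0 normr0 invr0.
rewrite normrZ normfV normrX normr_id expr2 invfM -mulrA mulVf ?mulr1//.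
by rewrite normr_eq0.
Qed.

Lemma inversionK : involutive inversion.
Proof.
move=> x; have [->|x0] := eqVneq x 0; first by rewrite /inversion !scaler0.
rewrite {1}/inversion norm_inversion /inversion scalerA exprVn invrK.
by rewrite divff ?scale1r// expf_neq0// normr_eq0.
Qed.

Lemma inversion_eq0 x : (inversion x == 0) = (x == 0).
Proof. by rewrite -normr_eq0 norm_inversion invr_eq0 normr_eq0. Qed.

Lemma inversion_continuous x : x != 0 -> {for x, continuous inversion}.
Proof.
move=> x0; apply: cvgZ; last exact: cvg_id.
apply: cvgV; first by rewrite expf_neq0// normr_eq0.
under eq_cvg do rewrite expr2.
by rewrite expr2; apply: cvgM; exact: norm_continuous.
Qed.

End Inversion.

(** * Janiszewski's theorem for a single common point *)

Section SinglePoint.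
Local Open Scope classical_set_scope.
Local Open Scope ring_scope.
Variable R : realType.

(** The inversion [iota] at [c] moves the common point to infinity. The new origin, which stands for
    infinity, is put into [A'] and left out of [B']. Then [A'] and [B'] are disjoint, and [B'] is
    closed because the bounded set [B] has no image near 0. The inverse [kappa] is continuous off 0,
    so the conclusion can be carried back. *)
Lemma janiszewski_point (A B : set (R * R)) c p q :
  closed A -> compact B -> A c -> B c -> (forall x, A x -> B x -> x = c) ->
  joined (~` A) p q -> joined (~` B) p q -> joined (~` (A `|` B)) p q.
Proof.
move=> clA cB Ac Bc ABc jA jB.
pose iota (x : R * R) := inversion (x - c).
pose kappa (y : R * R) := inversion y + c.
have iotaK x : kappa (iota x) = x by rewrite /kappa /iota inversionK subrK.
have iota0 x : x <> c -> iota x != 0.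
  by move=> xc; rewrite /iota inversion_eq0 subr_eq0; apply/eqP.
have c_iota x : x <> c -> {for x, continuous iota}.
  move=> xc; apply: continuous_comp; first by apply: cvgB; [exact: cvg_id|exact: cvg_cst].
  by apply: inversion_continuous; rewrite subr_eq0; apply/eqP.
have c_kappa y : y != 0 -> {for y, continuous kappa}.
  move=> y0; apply: cvgD; last exact: cvg_cst.
  exact: inversion_continuous.
have clB : closed B by apply: compact_closed => //; exact: norm_hausdorff.
pose A' := [set y : R * R | y = 0 \/ A (kappa y)].
pose B' := [set y : R * R | y != 0 /\ B (kappa y)].
have n0 (y : R * R) : y != 0 -> \forall z \near y, z != 0.
  move=> y0; apply: (@open_nbhs_nbhs _ y [set z | z != 0]); split => //.
  by rewrite openE => z /= z0; apply/nbhs_ballP; exists `|z|;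
    rewrite /= ?normr_gt0// => w; rewrite -ball_normE /=; apply: contraTneq => ->;
    rewrite subr0 ltxx.
have clA' : closed A'.
  rewrite -openC openE => y /= nA'y.
  have y0 : y != 0 by apply/eqP => y0; apply: nA'y; left.
  have nA : \forall z \near y, ~ A (kappa z).
    apply: (c_kappa _ y0 (~` A)); apply: open_nbhs_nbhs.
    split; first exact: closed_openC.
    by move=> Ay; apply: nA'y; right.
  by apply: filterS2 nA (n0 _ y0) => z nAz /eqP z0 [].
have clB' : closed B'.
  rewrite -openC openE => y /= nB'y.
  have [y0|y0] := eqVneq y 0; last first.
    have nB : \forall z \near y, ~ B (kappa z).
      apply: (c_kappa _ y0 (~` B)); apply: open_nbhs_nbhs.
      split; first exact: closed_openC.
      by move=> By; apply: nB'y.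
    by apply: filterS nB => z nB [].
  have [M [_ hM]] := compact_bounded cB.
  (* If z is nonzero of norm below 1/M', then [kappa z] has distance more than M + 1 + |c| from [c],
     hence norm more than M + 1, and lies outside [B]. *)
  pose M' := Num.max 1 (M + 1 + `|c|).
  have M'0 : 0 < M' by rewrite lt_max ltr01.
  rewrite y0; apply/nbhs_ballP; exists M'^-1 => /=; first by rewrite invr_gt0.
  move=> z; rewrite -ball_normE /= sub0r normrN => zM [z0 Bz].
  have : `|kappa z| <= M + 1 by apply: hM => //; rewrite ltrDl.
  apply/negP; rewrite -ltNge.
  have h : M' < `|inversion z|.
    by rewrite norm_inversion -(invrK M') ltf_pV2// posrE ?invr_gt0// normr_gt0.
  have h2 : `|inversion z| <= `|kappa z| + `|c|.
    by rewrite -{1}(addrK c (inversion z)) ler_normB.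
  have h3 : M + 1 + `|c| <= M' by rewrite le_max lexx orbT.
  lra.
have AB' : A' `&` B' = set0.
  apply/seteqP; split => // y [[y0|Ay] [yN0 By]]; first by rewrite y0 eqxx in yN0.
  have := ABc _ Ay By; rewrite /kappa => /eqP.
  by rewrite -subr_eq0 addrK inversion_eq0 (negbTE yN0).
have jA' : joined (~` A') (iota p) (iota q).
  apply: joined_image jA => x /= nAx.
    by apply: c_iota => xc; rewrite xc in nAx.
  move=> [/eqP|]; last by rewrite iotaK.
  by apply/negP/iota0 => xc; rewrite xc in nAx.
have jB' : joined (~` B') (iota p) (iota q).
  apply: joined_image jB => x /= nBx.
    by apply: c_iota => xc; rewrite xc in nBx.
  by move=> [_]; rewrite iotaK.
have := janiszewski_disjoint clA' clB' AB' jA' jB'.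
rewrite -{2}(iotaK p) -{2}(iotaK q); apply: joined_image => y /= nAB.
  by apply: c_kappa; apply/eqP => y0; apply: nAB; left; left.
move=> [Ay|By]; apply: nAB; first by left; right.
have [->|y0] := eqVneq y 0; first by left; left.
by right.
Qed.

(** The first hypothesis says that [f] is affine, so the set where it exceeds [a] is convex. *)
Lemma joined_halfplane (X : set (R * R)) (f : R * R -> R) a p q :
  (forall x y (t : R), f (x + t *: (y - x)) = f x + t * (f y - f x)) ->
  (forall x, a < f x -> X x) -> a < f p -> a < f q -> joined X p q.
Proof.
move=> fE fX ap aq; apply: joined_segment => t /andP[t0 t1]; apply: fX.
rewrite fE.
have h1 : 0 <= (1 - t) * (f p - a) by rewrite mulr_ge0 ?subr_ge0// ltW.
have [->|tN0] := eqVneq t 0; first by rewrite mul0r addr0.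
have h2 : 0 < t * (f q - a) by rewrite mulr_gt0 ?subr_gt0// lt_neqAle eq_sym tN0.
lra.
Qed.

(* The norm of R * R is the maximum norm, so this set is a union of four
   half-planes. *)
Lemma joined_outside_ball (c p q : R * R) (e : R) :
  0 < e -> e < `|p - c| -> e < `|q - c| ->
  joined [set x | e < `|x - c|] p q.
Proof.
(* The point [k] lies in both the eastern and the northern half-plane. From the west it is reached
   through the north-western corner, from the south through the south-eastern one. *)
move=> e0; pose k : R * R := (c.1 + e + e, c.2 + e + e).
suff key p' : e < `|p' - c| -> joined [set x | e < `|x - c|] p' k.
  by move=> hp hq; apply: (joined_trans (key _ hp)); apply/joined_sym/key.
have east x y : c.1 + e < x.1 -> c.1 + e < y.1 -> joined [set x | e < `|x - c|] x y.
  apply: (@joined_halfplane _ fst) => //= z h.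
  by rewrite prod_normE lt_max /= !ltr_normr; apply/orP; left; apply/orP; left; lra.
have north x y : c.2 + e < x.2 -> c.2 + e < y.2 -> joined [set x | e < `|x - c|] x y.
  apply: (@joined_halfplane _ snd) => //= z h.
  by rewrite prod_normE lt_max /= !ltr_normr; apply/orP; right; apply/orP; left; lra.
have west x y : e - c.1 < - x.1 -> e - c.1 < - y.1 -> joined [set x | e < `|x - c|] x y.
  apply: (@joined_halfplane _ (fun x => - x.1)) => [u v t|z h] /=.
    by rewrite /GRing.scale /=; ring.
  by rewrite prod_normE lt_max /= !ltr_normr; apply/orP; left; apply/orP; right; lra.
have south x y : e - c.2 < - x.2 -> e - c.2 < - y.2 -> joined [set x | e < `|x - c|] x y.
  apply: (@joined_halfplane _ (fun x => - x.2)) => [u v t|z h] /=.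
    by rewrite /GRing.scale /=; ring.
  by rewrite prod_normE lt_max /= !ltr_normr; apply/orP; right; apply/orP; right; lra.
rewrite prod_normE lt_max !ltr_normr /= => /orP[/orP[h|h]|/orP[h|h]].
- by apply: east => /=; lra.
- by apply: (@joined_trans _ _ (c.1 - e - e, c.2 + e + e));
    [apply: west|apply: north] => /=; lra.
- by apply: north => /=; lra.
- by apply: (@joined_trans _ _ (c.1 + e + e, c.2 - e - e));
    [apply: south|apply: east] => /=; lra.
Qed.

End SinglePoint.

(** * Adding an arc does not separate *)

Section Arcs.
Local Open Scope classical_set_scope.
Local Open Scope ring_scope.
Variable R : realType.

(** One radius serves all sets near [c], so a piece of arc can be chosen after the radius is
    known. *)
Lemma joined_off_small_set (c p q : R * R) : p <> c -> q <> c ->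
  exists2 e : R, 0 < e & forall B : set (R * R), B `<=` ball c e -> joined (~` B) p q.
Proof.
move=> /eqP pc /eqP qc; pose e := Num.min `|p - c| `|q - c| / 2.
have m0 : 0 < Num.min `|p - c| `|q - c| by rewrite lt_min !normr_gt0 !subr_eq0 pc.
have e0 : 0 < e by rewrite divr_gt0.
have em : e < Num.min `|p - c| `|q - c| by rewrite /e; lra.
move: em; rewrite lt_min => /andP[ep eq].
exists e => // B Bc; apply: joined_sub (joined_outside_ball e0 ep eq) => x /= ex /Bc.
by rewrite -ball_normE /= distrC ltNge ltW.
Qed.

Lemma joined_arc (K : set (R * R)) (g : R -> R * R) p q :
  closed K -> continuous g -> {in `[0, 1]%R &, injective g} ->
  (forall t, 0 < t <= 1 -> ~ K (g t)) ->
  (forall t, 0 <= t <= 1 -> g t <> p /\ g t <> q) ->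
  joined (~` K) p q -> joined (~` (K `|` g @` `[0, 1]%classic)) p q.
Proof.
move=> clK cg gi gK gpq jK.
pose S t := joined (~` (K `|` g @` `[0, t]%classic)) p q.
have cimg a b : compact (g @` `[a, b]%classic).
  apply: continuous_compact; last exact: segment_compact.
  exact: continuous_subspaceT.
have climg a b : closed (g @` `[a, b]%classic).
  by apply: compact_closed; [exact: norm_hausdorff|exact: cimg].
have img0 x : (g @` `[0, 0]%classic) x -> x = g 0.
  by move=> [t]; rewrite set_itv1 => ->.
(* At the start of the induction at most the single point [g 0] is added to [K]. *)
have S0 : S 0.
  have [Kg0|nKg0] := pselect (K (g 0)).
    by apply: joined_sub jK => x nKx [//|/img0 xg0]; apply: nKx; rewrite xg0.
  apply: janiszewski_disjoint => //.
    by apply/seteqP; split => // x [Kx /img0 xg0]; apply: nKg0; rewrite -xg0.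
  have g0pq : g 0 <> p /\ g 0 <> q by apply: gpq; rewrite lexx ler01.
  have [||e e0 he] := @joined_off_small_set (g 0) p q.
  - by case: g0pq => + _ h; rewrite h.
  - by case: g0pq => _ + h; rewrite h.
  by apply: he => x /img0 ->; exact: ballxx.
pose E := [set t | 0 <= t <= 1 /\ S t].
have E0 : E 0 by split => //; rewrite lexx ler01.
have ubE : ubound E 1 by move=> t [/andP[]].
have hE : has_sup E by split; [exists 0|exists 1].
pose s := sup E.
have s0 : 0 <= s by apply: ub_le_sup => //; exists 1.
have s1 : s <= 1 by apply: ge_sup => //; exists 0.
(* The supremum is attained: for [t] in [E] close enough to [s], the piece of the arc from [t] to
   [s] lies in a small ball around [g s], so it does not separate [p] from [q], and it meets what
   was added before only in [g t]. *)
have Ss : S s.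
  have gspq : g s <> p /\ g s <> q by apply: gpq; rewrite s0 s1.
  have [||e e0 he] := @joined_off_small_set (g s) p q.
  - by case: gspq => + _ h; rewrite h.
  - by case: gspq => _ + h; rewrite h.
  have /nbhs_ballP[d /= d0 hd] : nbhs s (g @^-1` ball (g s) e).
    by apply: cg; exact: nbhsx_ballx.
  have [t [/andP[t0 t1] St] st] := sup_adherent d0 hE.
  have ts : t <= s by apply: ub_le_sup; [exists 1|split; rewrite ?t0].
  have : joined (~` ((K `|` g @` `[0, t]%classic) `|` g @` `[t, s]%classic)) p q.
    apply: (@janiszewski_point _ _ _ (g t)) => //.
    - exact: closedU.
    - by right; exists t; rewrite //= in_itv /= t0 lexx.
    - by exists t; rewrite //= in_itv /= lexx.
    - move=> x [Kx|[r]] /=; rewrite ?in_itv /=.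
        move=> [r]; rewrite /= in_itv /= => /andP[tr rs] gr.
        (* The arc can meet [K] only at parameter 0, and then r = t = 0. *)
        have [r0|r0] := leP r 0; last first.
          by case: (gK r); rewrite ?gr// r0 (le_trans rs).
        by rewrite -gr; congr g; lra.
      move=> /andP[r0 rt] gr [r']; rewrite /= in_itv /= => /andP[tr' rs'] gr'.
      rewrite -gr; congr g; apply/eqP; rewrite eq_le rt /=.
      suff -> : r = r' by [].
      by apply: gi; rewrite ?in_itv /= ?gr ?gr'//; apply/andP; split; lra.
    - apply: he => x [r] /=; rewrite in_itv /= => /andP[tr rs] <-.
      apply: hd; rewrite -ball_normE /= ger0_norm ?subr_ge0//.
      move: st; rewrite -/s; lra.
  apply: joined_sub; apply: subsetC => x [Kx|[r]]; first by left; left.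
  rewrite /= in_itv /= => /andP[r0 rs] <-.
  have [rt|tr] := leP r t; [left; right|right]; exists r => //=; rewrite in_itv /=.
    by rewrite r0.
  by rewrite rs ltW.
suff -> : 1 = s by [].
apply/eqP; rewrite eq_le s1 andbT leNgt; apply/negP => s_lt1.
(* If s < 1, the compact set [C] that joins [p] to [q] misses [g s], hence also [g] at all
   parameters near [s]. The same [C] therefore works for some larger parameter [t]. *)
case: (Ss) => C [cC coC CX Cp Cq].
have clC : closed C by apply: compact_closed => //; exact: norm_hausdorff.
have /nbhs_ballP[d /= d0 hd] : nbhs s (g @^-1` (~` C)).
  apply: cg; apply: open_nbhs_nbhs; split; first exact: closed_openC.
  by move=> /CX; apply; right; exists s => //=; rewrite in_itv /= s0 lexx.
pose t := Num.min 1 (s + d / 2).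
have st : s < t by rewrite lt_min s_lt1 ltrDl divr_gt0.
have td : t <= s + d / 2 by rewrite ge_min lexx orbT.
suff Et : E t.
  have : t <= s by apply: ub_le_sup => //; exists 1.
  by rewrite leNgt st.
split; first by rewrite (le_trans s0 (ltW st)) ge_min lexx.
exists C; split => // x Cx [Kx|[r]]; first by apply: (CX _ Cx); left.
rewrite /= in_itv /= => /andP[r0 rt] gr.
have [rs|sr] := leP r s.
  by apply: (CX _ Cx); right; exists r => //=; rewrite in_itv /= r0.
apply: (hd r); last by rewrite /= gr.
by rewrite -ball_normE /= ltr0_norm; lra.
Qed.

End Arcs.

(** * Faces at a leaf *)

Section LeafFaces.
Local Open Scope classical_set_scope.
Local Open Scope ring_scope.
Variables (R : realType) (V : finType) (E : {set {set V}}).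
Hypothesis simpleE : simple_graph E.
Variable G : planar_embedding R E.

(** The curves of an embedding are continuous only within [0, 1]; clamping the parameter yields the
    globally continuous maps that [joined_arc] takes. *)
Lemma continuous_clamp (T : topologicalType) (g : R -> T) :
  {within `[0, 1], continuous g} ->
  continuous (fun t : R => g (Num.max 0 (Num.min 1 t))).
Proof.
move=> /subspace_continuousP cg t.
have c01 : `[0, 1]%classic (Num.max 0 (Num.min 1 t) : R).
  by rewrite /= in_itv /= le_max lexx ge_max ler01 ge_min lexx.
have ccl : {for t, continuous (fun t : R => Num.max 0 (Num.min 1 t) : R)}.
  apply: continuous_max; first exact: cvg_cst.
  by apply: continuous_min; [exact: cvg_cst|exact: cvg_id].
apply: cvg_comp (cg _ c01) => U /ccl hU; apply: filterS (hU : nbhs t _) => s /= h; apply: h.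
by rewrite /= in_itv /= le_max lexx ge_max ler01 ge_min lexx.
Qed.

Lemma vertex_on_curve e y (s : R) : e \in E -> 0 <= s <= 1 ->
  pe_curve G e s = pe_pos G y -> y \in e.
Proof.
move=> eE /andP[s0 s1] cy; have [u [v [euv c0 c1]]] := pe_curve_ends G eE.
have [s00|sN0] := eqVneq s 0.
  by move: cy; rewrite s00 c0 => /pe_pos_inj <-; rewrite euv !inE eqxx.
have [s11|sN1] := eqVneq s 1.
  by move: cy; rewrite s11 c1 => /pe_pos_inj <-; rewrite euv !inE eqxx orbT.
have h : 0 < s < 1 by rewrite !lt_neqAle s0 s1 eq_sym sN0 sN1.
by have := pe_curve_vertex G eE h y; rewrite cy eqxx.
Qed.

Lemma curve_interior_disjoint e e' (s s' : R) : e \in E -> e' \in E -> e != e' ->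
  0 < s < 1 -> 0 <= s' <= 1 -> pe_curve G e s <> pe_curve G e' s'.
Proof.
move=> eE e'E ee' hs /andP[s0 s1] c.
have [u [v [_ c0 c1]]] := pe_curve_ends G e'E.
have [s00|sN0] := eqVneq s' 0.
  by have := pe_curve_vertex G eE hs u; rewrite c s00 c0 eqxx.
have [s11|sN1] := eqVneq s' 1.
  by have := pe_curve_vertex G eE hs v; rewrite c s11 c1 eqxx.
have h : 0 < s' < 1 by rewrite !lt_neqAle s0 s1 eq_sym sN0 sN1.
by have := pe_curve_disjoint G eE e'E ee' hs h; rewrite c eqxx.
Qed.

(** An embedding does not prescribe which end of an edge has parameter 0. The map [h] between the
    two parametrizations is the identity or t -> 1 - t. *)
Lemma oriented_curve (a b : V) : [set a; b]%SET \in E ->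
  exists g : R -> R * R,
    [/\ continuous g, {in `[0, 1]%R &, injective g}, g 0 = pe_pos G a,
        g 1 = pe_pos G b &
        exists2 h : R -> R,
          (forall t, 0 <= t <= 1 -> g t = pe_curve G [set a; b]%SET (h t)) &
          [/\ involutive h, forall t, (0 <= h t <= 1) = (0 <= t <= 1) &
              forall t, (0 < h t < 1) = (0 < t < 1)]].
Proof.
set e := [set a; b]%SET => eE; have [u [v [euv c0 c1]]] := pe_curve_ends G eE.
have cl (t : R) : 0 <= t <= 1 -> Num.max 0 (Num.min 1 t) = t.
  by move=> /andP[t0 t1]; rewrite min_r// max_r.
have cc := continuous_clamp (pe_curve_continuous eE).
have ab : a != b by have := simpleE eE; rewrite /e cards2; case: eqP.
have uv : u != v by have := simpleE eE; rewrite euv cards2; case: eqP.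
have [[ua vb]|[va ub]] : (u = a /\ v = b) \/ (v = a /\ u = b).
  have : a \in [set u; v]%SET by rewrite -euv !inE eqxx.
  have : b \in [set u; v]%SET by rewrite -euv !inE eqxx orbT.
  rewrite !inE => /orP[]/eqP bE /orP[]/eqP aE; [|by right|by left|];
    by rewrite aE bE eqxx in ab.
- exists (fun t => pe_curve G e (Num.max 0 (Num.min 1 t))); split => //.
  + move=> s t; rewrite !in_itv /= => s01 t01; rewrite !cl//.
    by move=> /(pe_curve_inj eE); apply; rewrite in_itv.
  + by rewrite cl ?lexx ?ler01// c0 ua.
  + by rewrite cl ?lexx ?ler01// c1 vb.
  + by exists id => // t t01; rewrite cl.
- exists (fun t => pe_curve G e (Num.max 0 (Num.min 1 (1 - t)))); split => //.
  + move=> t; apply: (@continuous_comp _ _ _ (fun t : R => 1 - t)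
      (fun t => pe_curve G e (Num.max 0 (Num.min 1 t)))).
      by apply: cvgB; [exact: cvg_cst|exact: cvg_id].
    exact: cc.
  + move=> s t; rewrite !in_itv /= => /andP[s0 s1] /andP[t0 t1].
    rewrite !cl; [|by apply/andP; split; lra..].
    move=> /(pe_curve_inj eE) h.
    have : 1 - s = 1 - t by apply: h; rewrite in_itv /=; apply/andP; split; lra.
    lra.
  + by rewrite subr0 cl ?lexx ?ler01// c1 va.
  + by rewrite subrr cl ?lexx ?ler01// c0 ub.
  + exists (fun t => 1 - t).
      by move=> t /andP[t0 t1]; rewrite cl//; apply/andP; split; lra.
    split => t; first by ring.
      by apply/andP/andP => -[? ?]; split; lra.
    by apply/andP/andP => -[? ?]; split; lra.
Qed.

Lemma face_component f p : is_face G f -> f p ->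
  f = connected_component (~` drawing G) p /\ ~ drawing G p.
Proof.
move=> [x nDx ->] fp; split; first exact: same_connected_component.
exact: connected_component_sub fp.
Qed.

(** A point of [f] near [v], the curve [g] and a point of [f'] near [w] are connected off the closed
    set [K]. The hypothesis on [joined] then replaces [K] by the whole drawing. *)
Lemma faces_along_path (K : set (R * R)) (g : R -> R * R) v w f f' :
  closed K -> continuous g -> g 0 = pe_pos G w -> g 1 = pe_pos G v ->
  (forall t, 0 <= t <= 1 -> ~ K (g t)) ->
  (forall p q, ~ drawing G p -> ~ drawing G q -> joined (~` K) p q ->
     joined (~` drawing G) p q) ->
  is_face G f -> is_face G f' -> incident G v f -> incident G w f' -> f = f'.
Proof.
move=> clK cg g0 g1 gK jK ff ff' vf wf'.
have near_vertex t y h : is_face G h -> incident G y h -> 0 <= t <= 1 ->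
    g t = pe_pos G y -> exists2 p, h p & joined (~` K) p (pe_pos G y).
  move=> fh yh t01 gt.
  have /nbhs_ballP[e e0 he] : nbhs (pe_pos G y) (~` K).
    apply: open_nbhs_nbhs; split; first exact: closed_openC.
    by rewrite -gt; exact: gK.
  have [p [hp yp]] := yh _ (nbhsx_ballx _ _ e0).
  by exists p => //; apply: (joined_ball he) => //; exact: ballxx.
have [p fp jp] : exists2 p, f p & joined (~` K) p (pe_pos G v).
  by apply: (near_vertex 1) => //; rewrite ler01 lexx.
have [q fq jq] : exists2 q, f' q & joined (~` K) q (pe_pos G w).
  by apply: (near_vertex 0) => //; rewrite ler01 lexx.
have jwv : joined (~` K) (pe_pos G w) (pe_pos G v).
  by rewrite -g0 -g1; apply: joined_path.
have [fE nDp] := face_component ff fp; have [fE' nDq] := face_component ff' fq.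
rewrite fE fE'; apply/same_connected_component/joined_component/jK => //.
by apply: (joined_trans jp); apply/joined_sym; apply: (joined_trans jq).
Qed.

Lemma leaf_neighbour_face v w f f' : adj E v w -> deg E v = 1%N ->
  (deg E w <= 2)%N -> is_face G f -> is_face G f' ->
  incident G v f -> incident G w f' -> f = f'.
Proof.
rewrite /adj finset.setUC; set e0 := [set w; v]%SET => e0E degv degw ff ff' vf wf'.
have [g [cg gi g0 g1 [h ge0 [hK h01 hoo]]]] := oriented_curve e0E.
have vw : v != w by have := simpleE e0E; rewrite cards2 eq_sym; case: eqP.
have edge_v e : e \in E -> v \in e -> e = e0.
  move=> eE ve; move/eqP/cards1P: degv => [a aE].
  have : e \in [set e in E | v \in e]%SET by rewrite !inE eE ve.
  have : e0 \in [set e in E | v \in e]%SET by rewrite !inE e0E eqxx orbT.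
  by rewrite aE !inE => /eqP -> /eqP.
have g_vertex t y : 0 <= t <= 1 -> g t = pe_pos G y -> y = v \/ y = w.
  move=> t01; rewrite ge0// => /(vertex_on_curve e0E).
  by rewrite h01 => /(_ t01); rewrite !inE => /orP[]/eqP; [right|left].
(* Since [v] is a leaf, the other edges can meet the edge [e0] only at [w], which is [g 0]. *)
have g_curve e t s : e \in E -> e != e0 -> 0 < t <= 1 -> 0 <= s <= 1 ->
    g t <> pe_curve G e s.
  move=> eE ee0 /andP[t0 t1] s01.
  have [t_1|tN1] := eqVneq t 1.
    rewrite t_1 g1 => /esym /(vertex_on_curve eE s01) /(edge_v _ eE).
    by apply/eqP.
  rewrite ge0; last by rewrite t1 ltW.
  apply: curve_interior_disjoint => //; first by rewrite eq_sym.
  by rewrite hoo t0 lt_neqAle tN1.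
(* K1 is the drawing without v, w and the edges at w. *)
pose K1 := pe_pos G @` [set x | x != v /\ x != w] `|`
  \bigcup_(e in [set e : {set V} | e \in E /\ w \notin e]) (pe_curve G e @` `[0, 1]).
have clcurve e : e \in E -> closed (pe_curve G e @` `[0, 1]).
  move=> eE; apply: compact_closed; first exact: norm_hausdorff.
  by apply: continuous_compact; [exact: pe_curve_continuous|exact: segment_compact].
have clK1 : closed K1.
  apply: closedU.
    apply: accessible_finite_set_closed.1.
      by apply: hausdorff_accessible; exact: norm_hausdorff.
    by apply: finite_image; exact: finite_finset.
  apply: closed_bigcup; first exact: finite_finset.
  by move=> e [eE _]; exact: clcurve.
have w_edge e : e \in E -> w \notin e -> e != e0.
  by move=> eE; apply: contraNneq => ->; rewrite !inE eqxx.
have gK1 t : 0 <= t <= 1 -> ~ K1 (g t).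
  move=> t01 [[x [xv xw] xg]|[e [eE we] [s]]].
    have [/eqP|/eqP] := g_vertex t x t01 (esym xg); first by rewrite (negbTE xv).
    by rewrite (negbTE xw).
  rewrite /= in_itv /= => s01 sg; have [t0|tN0] := eqVneq t 0.
    by move: sg; rewrite t0 g0 => /(vertex_on_curve eE s01); exact/negP.
  apply: (@g_curve e t s) => //; first exact: w_edge.
  by move: t01; rewrite lt_neqAle eq_sym tN0.
have K1D : K1 `<=` drawing G.
  move=> y [[x _ <-]|[e [eE _] ey]]; first by left; exists x.
  by right; exists e.
have gD t : 0 <= t <= 1 -> drawing G (g t).
  move=> t01; right; exists e0 => //; rewrite ge0//.
  by exists (h t) => //=; rewrite in_itv /= h01.
have D_cases y : drawing G y -> [\/ K1 y, exists2 t, 0 <= t <= 1 & g t = y |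
    exists e, [/\ e \in E, w \in e, e != e0 & (pe_curve G e @` `[0, 1]) y]].
  move=> [[x _ <-]|[e /= eE ey]].
    have [->|xv] := eqVneq x v; first by constructor 2; exists 1; rewrite ?ler01 ?lexx.
    have [->|xw] := eqVneq x w; first by constructor 2; exists 0; rewrite ?ler01 ?lexx.
    by constructor 1; left; exists x.
  have [we|we] := boolP (w \in e); last by constructor 1; right; exists e.
  have [ee0|ee0] := eqVneq e e0; last by constructor 3; exists e.
  case: ey => s; rewrite /= in_itv /= => s01 <-; constructor 2; exists (h s).
    by rewrite h01.
  by rewrite ge0 ?h01// hK ee0.
have ng p t : ~ drawing G p -> 0 <= t <= 1 -> g t <> p.
  by move=> nDp t01 gp; apply: nDp; rewrite -gp; exact: gD.
(* If [e0] is the only edge at [w], the drawing is covered by [K1] and the arc [g], so a single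
   application of [joined_arc] suffices. *)
have [E1|[e1]] := set_0Vmem ([set e in E | w \in e] :\ e0)%SET.
  apply: (faces_along_path clK1 cg g0 g1 gK1) => // p q nDp nDq j.
  have : joined (~` (K1 `|` g @` `[0, 1]%classic)) p q.
    apply: joined_arc => // t /andP[t0 t1]; first by apply: gK1; rewrite t1 ltW.
    by split; apply: ng => //; rewrite t0.
  apply: joined_sub; apply: subsetC => y /D_cases[Ky|[t t01 gy]|[e [eE we ee0 _]]].
  - by left.
  - by right; exists t => //=; rewrite in_itv.
  - have : e \in ([set e in E | w \in e] :\ e0)%SET by rewrite !inE ee0 eE we.
    by rewrite E1 inE.
rewrite !inE => /and3P[e10 e1E we1].
have edge_w e : e \in E -> w \in e -> e != e0 -> e = e1.
  move=> eE we ee0; apply/eqP/negP => /negP ee1.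
  have : ([set e0; e1; e] \subset [set e in E | w \in e])%SET.
    apply/fintype.subsetP => z; rewrite !inE => /orP[/orP[]|] /eqP ->.
    - by rewrite e0E !inE eqxx.
    - by rewrite e1E we1.
    - by rewrite eE we.
  move=> /subset_leq_card; rewrite finset.setUC cardsU1 cards2 !inE.
  rewrite (negbTE ee0) (negbTE ee1) eq_sym e10 /= => /leq_trans /(_ degw).
  by [].
have [x e1x] : exists x, e1 = [set x; w]%SET.
  have [u [u' [e1u _ _]]] := pe_curve_ends G e1E.
  move: we1; rewrite e1u !inE => /orP[]/eqP ->; last by exists u.
  by exists u'; rewrite finset.setUC.
rewrite {}e1x in e10 e1E we1 edge_w; set e1' := [set x; w]%SET in e10 e1E we1 edge_w.
have [b [cb bi b0 b1 [k be1 [kK k01 koo]]]] := oriented_curve e1E.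
have b_vertex t y : 0 < t <= 1 -> b t = pe_pos G y -> y = w.
  move=> /andP[t0 t1]; have [->|tN1] := eqVneq t 1.
    by rewrite b1 => /pe_pos_inj.
  have t_oo : 0 < k t < 1 by rewrite koo t0 lt_neqAle tN1.
  rewrite be1; last by rewrite t1 ltW.
  by move=> by_; have := pe_curve_vertex G e1E t_oo y; rewrite by_ eqxx.
have b_g t s : 0 < t <= 1 -> 0 <= s <= 1 -> g t <> b s.
  by move=> t01 s01; rewrite be1//; apply: g_curve; rewrite ?k01.
(* The curve [b] runs from the other end [x] of the second edge to [w]. Its first half is kept in
   [K0], so the second half [b'] meets [K0] only in its first point. *)
pose b' (t : R) := b (2^-1 + 2^-1 * t).
have cb' : continuous b'.
  move=> t; apply: (@continuous_comp _ _ _ (fun t : R => 2^-1 + 2^-1 * t) b).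
    apply: cvgD; first exact: cvg_cst.
    by apply: cvgM; [exact: cvg_cst|exact: cvg_id].
  exact: cb.
pose K0 := K1 `|` b @` `[0, 2^-1]%classic.
have clb c d : closed (b @` `[c, d]%classic).
  apply: compact_closed; first exact: norm_hausdorff.
  apply: continuous_compact; last exact: segment_compact.
  exact: continuous_subspaceT.
have clK0 : closed K0 by exact: closedU.
have gK0 t : 0 <= t <= 1 -> ~ K0 (g t).
  move=> t01 [|[s]]; first exact: gK1.
  rewrite /= in_itv /= => /andP[s0 s1] bg; have [t0|tN0] := eqVneq t 0.
    move: bg; rewrite t0 g0 -b1 => /bi; rewrite !in_itv /=.
    have -> : 0 <= s <= 1 by apply/andP; split; lra.
    by rewrite ler01 lexx => /(_ isT isT); lra.
  apply: (@b_g t s) => //; last by apply/andP; split; lra.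
  by move: t01; rewrite lt_neqAle eq_sym tN0.
have b'K0 t : 0 < t <= 1 -> ~ K0 (b' t).
  move=> /andP[t0 t1]; rewrite /b'; set r := (2^-1 + _).
  have r0 : 2^-1 < r by rewrite /r; lra.
  have r1 : r <= 1 by rewrite /r; lra.
  move=> [[[y [_ yw] yb]|[e [eE we] [s]]]|[s]].
  - move: yw; rewrite (@b_vertex r y) ?eqxx//; apply/andP; split => //; lra.
  - rewrite /= in_itv /= => s01 sb.
    have [r_1|rN1] := eqVneq r 1.
      by move: sb; rewrite r_1 b1 => /(vertex_on_curve eE s01); exact/negP.
    have r01 : 0 <= r <= 1 by rewrite r1; lra.
    move: sb; rewrite be1// => /esym; apply: curve_interior_disjoint => //.
      by apply: contraNneq we => <-; rewrite !inE eqxx orbT.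
    rewrite koo; apply/andP; split; [lra|by rewrite lt_neqAle rN1].
  - rewrite /= in_itv /= => /andP[s0 s1] sb.
    have : s = r by apply: bi; rewrite ?in_itv //=; apply/andP; split; lra.
    lra.
have b'D t : 0 <= t <= 1 -> drawing G (b' t).
  move=> /andP[t0 t1]; right; exists e1' => //.
  have r01 : 0 <= 2^-1 + 2^-1 * t <= 1 by apply/andP; split; lra.
  by rewrite /b' be1//; exists (k (2^-1 + 2^-1 * t)) => //=; rewrite in_itv /= k01.
apply: (faces_along_path clK0 cg g0 g1 gK0) => // p q nDp nDq j.
(* The arc [b'] is put back first. Afterwards [g] meets the set obtained only in its first point,
   the vertex [w]. *)
have {}j : joined (~` (K0 `|` b' @` `[0, 1]%classic)) p q.
  apply: joined_arc => //.
    move=> s t; rewrite !in_itv /= => /andP[s0 s1] /andP[t0 t1] /bi st.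
    have : 2^-1 + 2^-1 * s = 2^-1 + 2^-1 * t.
      by apply: st; rewrite in_itv /=; apply/andP; split; lra.
    lra.
  by move=> t t01; split=> bt; [apply: nDp|apply: nDq]; rewrite -bt; exact: b'D.
have : joined (~` ((K0 `|` b' @` `[0, 1]%classic) `|` g @` `[0, 1]%classic)) p q.
  apply: joined_arc => //.
  - apply: closedU => //; apply: compact_closed; first exact: norm_hausdorff.
    apply: continuous_compact; last exact: segment_compact.
    exact: continuous_subspaceT.
  - move=> t /andP[t0 t1] [|[s]]; first by apply: gK0; rewrite t1 ltW.
    rewrite /= in_itv /= => /andP[s0 s1] /esym; apply: b_g; first by rewrite t0.
    by apply/andP; split; lra.
  - by move=> t t01; split; exact: ng.
apply: joined_sub; apply: subsetC => y /D_cases[Ky|[t t01 gy]|[e [eE we ee0]]].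
- by left; left; left.
- by right; exists t => //=; rewrite in_itv.
rewrite (edge_w _ eE we ee0) => -[s]; rewrite /= in_itv /= => s01 <-; left.
have -> : pe_curve G e1' s = b (k s) by rewrite be1 ?k01// kK.
move: s01; rewrite -k01 => /andP[ks0 ks1].
have [ks|ks] := leP (k s) 2^-1.
  by left; right; exists (k s) => //=; rewrite in_itv /= ks0.
right; exists (2 * k s - 1) => /=; last by rewrite /b'; congr b; lra.
by rewrite in_itv /=; apply/andP; split; lra.
Qed.

End LeafFaces.

(** * Exhaustive checks of small graphs *)

Section Models.
Local Open Scope nat_scope.

Fixpoint words (T : Type) (A : seq T) (n : nat) : seq (seq T) :=
  if n is n'.+1 then [seq a :: s | a <- A, s <- words A n'] else [:: [::]].

(** Strictly lower triangular boolean matrices, one for each simple graph on the indices below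
    [n]. *)
Fixpoint triangles (n : nat) : seq (seq (seq bool)) :=
  if n is n'.+1 then [seq rcons t r | t <- triangles n', r <- words [:: true; false] n']
  else [:: [::]].

(* Row j of t lists the adjacency of j with the smaller indices. *)
Definition tadj (t : seq (seq bool)) (i j : nat) : bool :=
  if i < j then nth false (nth [::] t j) i
  else if j < i then nth false (nth [::] t i) j else false.

Definition pairs (n : nat) : seq (nat * nat) :=
  flatten [seq [seq (i, j) | i <- iota 0 j] | j <- iota 0 n].

Definition touches (i : nat) (p : nat * nat) : bool := (i == p.1) || (i == p.2).

Definition lower (r : seq nat) (p : nat * nat) : seq nat :=
  mkseq (fun i => nth 0 r i - touches i p) (size r).

(** Backtracking: every pair is either used as a new edge or skipped, and [r] holds the free
    valencies still to be filled. The recursive calls sit in conditionals because [vm_compute]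
    evaluates both arguments of a boolean operation. *)
Fixpoint search (h : nat -> nat -> bool) (ps : seq (nat * nat)) (r : seq nat) : bool :=
  if ps is p :: ps' then
    if (if [|| h p.1 p.2, nth 0 r p.1 == 0 | nth 0 r p.2 == 0] then false
        else search h ps' (lower r p))
    then true else search h ps' r
  else all (fun k => k == 0) r.

Definition osum (n : nat) (F : nat -> nat) (S : seq nat) : nat :=
  sumn [seq F i | i <- iota 0 n & i \notin S].

(* The joker condition is missing because it follows from parity. *)
Definition model_conditions (n : nat) (d : nat -> nat) (h : nat -> nat -> bool) : bool :=
  all (fun i =>
    [&& (d i == 2) && ~~ has (h i) (iota 0 n) ==> (2 < n),
        (d i == 3) ==> (3 < n) &
    all (fun j =>
      [&& [&& d i == 1, d j == 1 & h i j] ==> (2 <= osum n d [:: i; j]),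
          [&& d i == 2, d j == 1 & h i j] ==>
            (3 <= osum n (fun w => if h j w then 1 else minn 2 (d w)) [:: i; j]),
          [&& d i == 2, d j == 2 & h i j] ==>
            (4 <= osum n (fun w => minn 2 (d w)) [:: i; j]),
          [&& i != j, d i == 3 & d j == 3] ==>
            (4 <= osum n (fun w => minn 2 (d w)) [:: i; j]) &
      all (fun k =>
        [&& d i == 1, d j == 1, d k == 1, h i j, h j k & h k i] ==>
            (3 <= osum n d [:: i; j; k])) (iota 0 n)]) (iota 0 n)]) (iota 0 n).

(** An inequality in the second clause, because a vertex may also have neighbours outside the set
    under consideration. *)
Definition admissible (n : nat) (d : nat -> nat) (h : nat -> nat -> bool) : bool :=
  all (fun i => 0 < d i) (iota 0 n) &&
  all (fun i => d i + count (h i) (iota 0 n) <= 3) (iota 0 n).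

(** The first test follows from admissibility, where every [d i] is positive; it discards a graph
    before its valencies are enumerated. *)
Definition every_model (n : nat) (D : seq nat)
    (P : seq nat -> (nat -> nat -> bool) -> bool) : bool :=
  all (fun t =>
    if all (fun i => count (tadj t i) (iota 0 n) <= 2) (iota 0 n) then
      all (fun d => if admissible n (nth 0 d) (tadj t) then P d (tadj t) else true)
        (words D n)
    else true) (triangles n).

(** An equality of booleans, so that one computation yields both directions of the equivalence. *)
Definition small_model (n : nat) : bool :=
  every_model n [:: 1; 2; 3] (fun d h =>
    search h (pairs n) d ==
    ~~ odd (sumn d) && model_conditions n (nth 0 d) h).

Lemma small_models : all small_model (iota 0 5).
Proof. by vm_compute. Qed.

Lemma five_models : every_model 5 [:: 1; 2; 3] (fun d h =>
  if odd (sumn d) then true else search h (pairs 5) d).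
Proof. by vm_compute. Qed.

Lemma six_models : every_model 6 [:: 1] (fun d h => search h (pairs 6) d).
Proof. by vm_compute. Qed.

End Models.

(** * Correctness of the enumeration and the search *)

Section ModelTheory.
Local Open Scope nat_scope.

Lemma mem_words (T : eqType) (A s : seq T) : all [in A] s -> s \in words A (size s).
Proof.
elim: s => //= a s IH /andP[aA /IH sA].
by apply/allpairsP; exists (a, s).
Qed.

Lemma mem_triangles n (h : nat -> nat -> bool) :
  mkseq (fun j => mkseq (fun i => h i j) j) n \in triangles n.
Proof.
elim: n => //= n IH; rewrite mkseqS; apply/allpairsP.
exists (mkseq (fun j => mkseq (fun i => h i j) j) n, mkseq (fun i => h i n) n).
split => //=.
have := @mem_words _ [:: true; false] (mkseq (fun i => h i n) n).
by rewrite size_mkseq; apply; apply/allP => -[].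
Qed.

Lemma tadj_mkseq n (h : nat -> nat -> bool) i j :
  symmetric h -> irreflexive h -> i < n -> j < n ->
  tadj (mkseq (fun j => mkseq (fun i => h i j) j) n) i j = h i j.
Proof.
move=> hs hi lin ljn; rewrite /tadj; case: ltngtP => ij.
- by rewrite nth_mkseq// nth_mkseq.
- by rewrite nth_mkseq// nth_mkseq// hs.
- by rewrite ij hi.
Qed.

Lemma mem_pairs n p : (p \in pairs n) = (p.1 < p.2 < n).
Proof.
case: p => i j; apply/flatten_mapP/idP => /=.
  case=> k; rewrite mem_iota => /= kn /mapP[l]; rewrite mem_iota => /= lk [-> ->].
  by rewrite lk.
move=> /andP[ij jn]; exists j; rewrite ?mem_iota//.
by apply/mapP; exists i; rewrite ?mem_iota.
Qed.

Lemma pairs_uniq n : uniq (pairs n).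
Proof.
have -> : pairs n = [seq (i, j) | j <- iota 0 n, i <- iota 0 j] by [].
apply: allpairs_uniq_dep; first exact: iota_uniq.
  by move=> j _; exact: iota_uniq.
by move=> [a b] [c d] _ _ [-> ->].
Qed.

Lemma searchP h ps r : all (fun p => (p.1 < size r) && (p.2 < size r)) ps ->
  search h ps r <-> exists t, [/\ subseq t ps, all (fun p => ~~ h p.1 p.2) t &
    forall i, i < size r -> nth 0 r i = count (touches i) t].
(* The list [t] records the pairs used along a successful branch of the search. *)
Proof.
elim: ps r => [|p ps IH] r.
  move=> _; split => [/= r0|[t [/= /eqP-> _ tr]]].
    exists [::]; split => // i ir; apply/eqP.
    by move/allP: r0; apply; exact: mem_nth.
  by apply/(all_nthP 0) => i ir; rewrite tr.
move=> /= /andP[/andP[p1 p2] psr].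
have size_lower : size (lower r p) = size r by rewrite size_mkseq.
have psr' : all (fun q => (q.1 < size (lower r p)) && (q.2 < size (lower r p))) ps.
  by rewrite size_lower.
split.
  case: ifP => [+ _|_].
    case: ifP => // /negbT; rewrite !negb_or => /and3P[hp r1 r2] /(IH _ psr')[t [tps th]].
    rewrite size_lower => tr.
    exists (p :: t); split; rewrite /= ?eqxx ?hp// => i ir.
    (* The search uses [p] only if both ends have a free valency left, so the truncated subtraction
       in [lower] loses nothing. *)
    have := tr _ ir; rewrite nth_mkseq// => <-; rewrite subnKC//.
    rewrite /touches; case: (eqVneq i p.1) => [->|_]; first by rewrite lt0n.
    by case: (eqVneq i p.2) => [->|_] //; rewrite lt0n.
  move=> /(IH _ psr)[t [tps th tr]]; exists t; split => //.
  exact: subseq_trans tps (subseq_cons _ _).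
move=> [t [tps th tr]].
have skip : subseq t ps -> search h ps r.
  by move=> tps'; apply/IH => //; exists t.
case: t tps th tr skip => [|q t] /= => [_ _ tr skip|].
  by case: ifP => // _; apply: skip; exact: sub0seq.
case: eqVneq => [->|_] tps => [/andP[hp th] tr _|_ _ ->//]; last by case: ifP.
have r1 := tr _ p1; have r2 := tr _ p2.
rewrite (negbTE hp) r1 r2 /touches !eqxx orbT /=.
suff -> : search h ps (lower r p) by [].
apply/(IH _ psr'); exists t; split => // i; rewrite size_lower => ir.
by rewrite nth_mkseq// tr// addKn.
Qed.

End ModelTheory.

(** * Passing from a vertex set to its indices *)

Section Transfer.
Local Open Scope nat_scope.
Variables (V : finType) (E : {set {set V}}) (U : {set V}).
Hypothesis simpleE : simple_graph E.
Variables (n : nat) (x : nat -> V).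
Hypothesis x_inj : {in gtn n &, injective x}.
Hypothesis memU : forall v, (v \in U) = (v \in map x (iota 0 n)).

Lemma adj_sym : symmetric (adj E).
Proof. by move=> u v; rewrite /adj finset.setUC. Qed.

Lemma adj_irr : irreflexive (adj E).
Proof.
move=> u; apply/negP; rewrite /adj finset.setUid => /simpleE.
by rewrite cards1.
Qed.

Lemma xU i : i < n -> x i \in U.
Proof. by move=> i_n; rewrite memU map_f// mem_iota. Qed.

Lemma Ux v : v \in U -> exists2 i, i < n & v = x i.
Proof. by rewrite memU => /mapP[i]; rewrite mem_iota => /= ? ->; exists i. Qed.

Lemma map_x_uniq : uniq (map x (iota 0 n)).
Proof.
rewrite map_inj_in_uniq ?iota_uniq// => i j; rewrite !mem_iota => /= ? ?.
exact: x_inj.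
Qed.

Lemma sumU (P : pred V) (G : V -> nat) :
  \sum_(v in U | P v) G v = \sum_(i <- iota 0 n | P (x i)) G (x i).
Proof.
rewrite -big_filter_cond -(big_map x P G); apply: perm_big.
apply: uniq_perm; first by rewrite filter_uniq// index_enum_uniq.
  exact: map_x_uniq.
by move=> v; rewrite mem_filter mem_index_enum andbT memU.
Qed.

Lemma eq_x i j : i < n -> j < n -> (x i == x j) = (i == j).
Proof. by move=> ? ?; apply/eqP/eqP => [/x_inj|->//]; apply. Qed.

Definition edge (p : nat * nat) : {set V} := [set x p.1; x p.2].

Lemma edge_inj : {in pairs n &, injective edge}.
Proof.
move=> [i j] [k l]; rewrite !mem_pairs /= => /andP[ij jn] /andP[kl ln] e.
have i_n := ltn_trans ij jn; have k_n := ltn_trans kl ln.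
have : x i \in edge (k, l) by rewrite -e !inE eqxx.
have : x j \in edge (k, l) by rewrite -e !inE eqxx orbT.
rewrite !inE /= !eq_x//.
move=> /orP[]/eqP jE /orP[]/eqP iE; subst => //; by rewrite ?ltnn// in ij; lia.
Qed.

Lemma mem_edge i p : i < n -> p \in pairs n -> (x i \in edge p) = touches i p.
Proof.
case: p => k l; rewrite mem_pairs /= => i_n /andP[kl ln].
by rewrite !inE /= !eq_x// (ltn_trans kl).
Qed.

Lemma deg_edges (t : seq (nat * nat)) (W : {set {set V}}) i :
  uniq t -> {subset t <= pairs n} -> W =i map edge t -> i < n ->
  deg W (x i) = count (touches i) t.
Proof.
move=> ut tp Wt i_n; rewrite /deg -size_filter -(size_map edge).
have tp' : {subset seq.filter (touches i) t <= pairs n}.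
  by move=> p; rewrite mem_filter => /andP[_ /tp].
have u : uniq (map edge (seq.filter (touches i) t)).
  rewrite map_inj_in_uniq ?filter_uniq// => p q /tp' pp /tp' qp.
  exact: edge_inj.
rewrite -(card_uniqP u); apply: eq_card => e; rewrite !inE Wt.
apply/andP/mapP => [[/mapP[p pt ->]]|[p]].
  by rewrite mem_edge ?tp// => ip; exists p => //; rewrite mem_filter ip.
rewrite mem_filter => /andP[ip pt] ->; rewrite mem_edge ?tp//.
by split => //; apply: map_f.
Qed.

Lemma degU (W : {set {set V}}) v : (forall e, e \in W -> e \notin E) ->
  deg (E :|: W) v = deg E v + deg W v.
Proof.
move=> WE; rewrite /deg -cardsUI.
have -> : [set e in E | v \in e] :&: [set e in W | v \in e] = finset.set0.
  apply/setP => e; rewrite !inE; apply/negP => /andP[/andP[eE _] /andP[/WE]].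
  by rewrite eE.
rewrite cards0 addn0; apply: eq_card => e; rewrite !inE.
by rewrite andb_orl.
Qed.

Variables (d : seq nat) (h : nat -> nat -> bool).
Hypothesis size_d : size d = n.
Hypothesis dE : forall i, i < n -> nth 0 d i = free_val E (x i).
Hypothesis hE : forall i j, i < n -> j < n -> h i j = adj E (x i) (x j).
Hypothesis deg3 : forall v, deg E v <= 3.

(** A set [W] corresponds to the subsequence of pairs whose edges it contains. As [W] avoids [E],
    degree 3 in the union means that each vertex lies on as many edges of [W] as it has free
    valencies. *)
Lemma realizable_search : realizable_set E U <-> search h (pairs n) d.
Proof.
have range : all (fun p => (p.1 < size d) && (p.2 < size d)) (pairs n).
  apply/allP => -[i j]; rewrite mem_pairs size_d /= => /andP[ij jn].
  by rewrite jn (ltn_trans ij).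
split.
  move=> [W [WU WE Wd]]; apply/searchP => //.
  pose t := [seq p <- pairs n | edge p \in W].
  exists t; split; first exact: filter_subseq.
    apply/allP => -[i j]; rewrite mem_filter mem_pairs /= => /and3P[ijW ij jn].
    by rewrite hE ?(ltn_trans ij)//; exact: WE.
  rewrite size_d => i i_n; rewrite dE//.
  rewrite -(@deg_edges t W) ?filter_uniq ?pairs_uniq//.
  - by rewrite /free_val -(Wd _ (xU i_n)) degU// addKn.
  - by move=> p; rewrite mem_filter => /andP[].
  - move=> e; apply/idP/mapP => [eW|[p]]; last by rewrite mem_filter => /andP[+ _] ->.
    have [eU /eqP/cards2P[u [v [uv e_uv]]]] := WU _ eW.
    have [i' i'n ui] : exists2 i, i < n & u = x i.
      by apply: Ux; move/fintype.subsetP: eU; apply; rewrite e_uv !inE eqxx.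
    have [j jn vj] : exists2 i, i < n & v = x i.
      by apply: Ux; move/fintype.subsetP: eU; apply; rewrite e_uv !inE eqxx orbT.
    have : i' != j by apply: contraNneq uv => ij; rewrite ui vj ij.
    rewrite neq_ltn => /orP[ij|ij].
      exists (i', j); last by rewrite e_uv ui vj.
      by rewrite mem_filter mem_pairs /= ij jn /edge /= -ui -vj -e_uv eW.
    exists (j, i'); last by rewrite e_uv ui vj /edge finset.setUC.
    by rewrite mem_filter mem_pairs /= ij i'n /edge /= -ui -vj finset.setUC -e_uv eW.
move=> /(searchP _ range)[t [tp th tr]].
have tp' : {subset t <= pairs n} by exact: mem_subseq.
have ut : uniq t by apply: subseq_uniq tp (pairs_uniq n).
pose W := [set e | e \in map edge t].
have We : W =i map edge t by move=> e; rewrite inE.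
have WE e : e \in W -> e \notin E.
  rewrite We => /mapP[[i j] ijt ->]; move/allP: th => /(_ _ ijt) /=.
  by move: (tp' _ ijt); rewrite mem_pairs /= => /andP[ij jn]; rewrite hE ?(ltn_trans ij).
exists W; split => //.
  move=> e; rewrite We => /mapP[[i j] /tp' + ->]; rewrite mem_pairs /= => /andP[ij jn].
  have i_n := ltn_trans ij jn; rewrite /edge /= cards2 eq_x// ltn_eqF//; split => //.
  by apply/fintype.subsetP => v; rewrite !inE => /orP[]/eqP ->; exact: xU.
move=> v /Ux[i i_n ->]; rewrite degU// (deg_edges ut tp' We i_n).
by rewrite -tr ?size_d// dE// subnKC.
Qed.

Lemma neighbours_le_deg i : i < n -> count (h i) (iota 0 n) <= deg E (x i).
Proof.
move=> i_n; pose s := [seq [set x i; x j] | j <- iota 0 n & h i j].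
have -> : count (h i) (iota 0 n) = size s by rewrite size_map size_filter.
have us : uniq s.
  rewrite map_inj_in_uniq ?filter_uniq ?iota_uniq// => j k.
  rewrite !mem_filter !mem_iota => /= /andP[ij jn] /andP[ik kn] e.
  have : x j \in [set x i; x k] by rewrite -e !inE eqxx orbT.
  rewrite !inE !eq_x// => /orP[/eqP ji|/eqP//].
  by move: ij; rewrite ji hE// adj_irr.
rewrite -(card_uniqP us); apply/subset_leq_card/fintype.subsetP => e /mapP[j].
rewrite mem_filter mem_iota => /= /andP[ij jn] ->.
by rewrite !inE eqxx andbT; move: ij; rewrite hE.
Qed.

Lemma transfer_admissible : (forall v, v \in U -> deg E v <= 2) ->
  admissible n (nth 0 d) h.
Proof.
move=> deg2; apply/andP; split; apply/allP => i; rewrite mem_iota => /= i_n; rewrite dE//.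
  by rewrite subn_gt0 ltnS deg2// xU.
have := neighbours_le_deg i_n; have := deg3 (x i); rewrite /free_val; lia.
Qed.

Lemma sumn_d : sumn d = \sum_(v in U) free_val E v.
Proof.
have -> : d = [seq free_val E (x i) | i <- iota 0 n].
  apply: (@eq_from_nth _ 0); first by rewrite size_map size_iota.
  by move=> i; rewrite size_d => i_n; rewrite (nth_map 0) ?size_iota// nth_iota// dE.
have -> : \sum_(v in U) free_val E v = \sum_(v in U | true) free_val E v.
  by apply: eq_bigl => v; rewrite andbT.
by rewrite sumU sumnE big_map.
Qed.

Lemma osumE (F : nat -> nat) (G : V -> nat) (S : seq nat) (T : {set V}) :
  (forall i, i < n -> F i = G (x i)) -> {in gtn n, forall i, (x i \in T) = (i \in S)} ->
  osum n F S = \sum_(v in U :\: T) G v.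
Proof.
move=> FG TS; rewrite /osum sumnE big_map big_filter.
have -> : \sum_(v in U :\: T) G v = \sum_(v in U | v \notin T) G v.
  by apply: eq_bigl => v; rewrite inE andbC.
rewrite (sumU (fun v => v \notin T)).
rewrite big_seq_cond [RHS]big_seq_cond; apply: eq_big => i; rewrite mem_iota /=.
  by case: ltnP => //= i_n; rewrite TS.
by move=> /andP[i_n _]; rewrite FG.
Qed.

End Transfer.

(** * Realizability *)

Section Conditions.
Local Open Scope nat_scope.
Variables (V : finType) (E : {set {set V}}).
Hypothesis simpleE : simple_graph E.
Hypothesis deg3 : forall v, deg E v <= 3.

Lemma card_neighbours v : #|[set w | adj E v w]| = deg E v.
Proof.
have adj_inj : {in [set w | adj E v w] &, injective (fun w => [set v; w])}.
  move=> w w'; rewrite !inE => vw vw' e.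
  have : w \in [set v; w'] by rewrite -e !inE eqxx orbT.
  rewrite !inE => /orP[/eqP wv|/eqP//].
  by move: vw; rewrite wv adj_irr.
rewrite -(card_in_imset adj_inj); apply: eq_card => e.
apply/imsetP/idP => [[w]|]; rewrite !inE.
  by move=> vw ->; rewrite !inE eqxx andbT.
move=> /andP[eE ve]; have /eqP/cards2P[a [b [ab e_ab]]] := simpleE eE.
move: ve; rewrite e_ab !inE => /orP[]/eqP ve.
  by exists b; rewrite ?inE /adj ve -?e_ab.
by exists a; rewrite ?inE /adj ve finset.setUC -?e_ab.
Qed.

Lemma free_valE k v : k <= 3 -> (free_val E v == k) = (v \in Vdeg E (3 - k)).
Proof. by rewrite inE /free_val; have := deg3 v; lia. Qed.

(** Induction on [m]: some weight is still below its bound and is raised by one. *)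
Lemma exists_subweight (T : finType) (S : {set T}) (c : T -> nat) m :
  m <= \sum_(w in S) c w ->
  exists2 k : T -> nat, (forall w, k w <= c w) & \sum_(w in S) k w = m.
Proof.
elim: m => [_|m IH mc]; first by exists (fun=> 0); rewrite // big1.
have [k kc km] := IH (ltnW mc).
have [w wS kw] : exists2 w, w \in S & k w < c w.
  apply/exists_inP; apply: contraTT mc => /exists_inPn h.
  rewrite -leqNgt -km; apply: leq_sum => w /h; by rewrite -leqNgt.
exists (fun v => k v + (v == w)).
  by move=> v; case: eqP => [->|_]; rewrite ?addn1 ?addn0.
by rewrite big_split /= km (bigD1 w)//= eqxx big1 ?addn0 ?addn1// => v /andP[_ /negbTE ->].
Qed.

(** Three valencies on at least two vertices means at most two from each vertex. Since [S] has at
    most one neighbour of [r], the bound on neighbours also concerns a single vertex, and the whole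
    requirement becomes a sum of capacities. *)
Lemma branch_choice (S : {set V}) r : {in S, forall w, 0 < free_val E w} ->
  #|[set w in S | adj E r w]| <= 1 ->
  (exists k : V -> nat,
    [/\ forall w, w \in S -> k w <= free_val E w,
        \sum_(w in S) k w = 3,
        2 <= #|[set w in S | 0 < k w]| &
        \sum_(w in S | adj E r w) k w <= 1]) <->
  3 <= \sum_(w in S) (if adj E r w then 1 else minn 2 (free_val E w)).
Proof.
move=> Sfree Sr; split.
  move=> [k [kfree k3 k2 kr]]; rewrite -k3; apply: leq_sum => w wS.
  case: ifP => rw.
    apply: leq_trans kr; rewrite (bigD1 w) ?wS//=; exact: leq_addr.
  rewrite leq_min kfree// andbT leqNgt; apply/negP => kw.
  have others v : v \in S -> v != w -> k v = 0.
    move=> vS vw; move: k3; rewrite (bigD1 w)//= (bigD1 v) ?vS//=; lia.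
  have : #|[set v in S | 0 < k v]| <= #|[set w]|; last by rewrite cards1; move: k2; lia.
  apply/subset_leq_card.
  apply/fintype.subsetP => v; rewrite !inE => /andP[vS].
  by apply: contraTT => vw; rewrite (others v vS vw).
move=> /exists_subweight[k kc k3]; exists k; split => //.
- move=> w wS; apply: leq_trans (kc w) _; case: ifP => _; first exact: Sfree.
  exact: geq_minr.
- have : \sum_(w in S) k w <= \sum_(w in [set w in S | 0 < k w]) 2.
    have -> : \sum_(w in [set w in S | 0 < k w]) 2 = \sum_(w in S) (if 0 < k w then 2 else 0).
      by rewrite -big_mkcondr /=; apply: eq_bigl => w; rewrite inE.
    apply: leq_sum => w _; case: ltnP => // _; apply: leq_trans (kc w) _.
    by case: ifP => // _; exact: geq_minl.
  by rewrite k3 sum_nat_const; lia.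
- apply: leq_trans Sr; rewrite -sum1_card.
  have -> : \sum_(w in [set w in S | adj E r w]) 1 = \sum_(w in S | adj E r w) 1.
    by apply: eq_bigl => w; rewrite inE.
  by apply: leq_sum => w /andP[_ rw]; have := kc w; rewrite rw.
Qed.

Variable U : {set V}.
Hypothesis U_free : {in U, forall v, 0 < free_val E v}.

Lemma free_vertices1 v : v \in U -> free_vertices E (U :\: [set v]) = #|U|.-1.
Proof.
move=> vU; rewrite (cardsD1 v U) vU /=; apply: eq_card => w; rewrite !inE.
by case: eqP => //= _; case: (boolP (w \in U)) => //= /U_free.
Qed.

Lemma branch_neighbours u r : r \in Vdeg E 2 -> adj E u r ->
  #|[set w in U :\: [set u; r] | adj E r w]| <= 1.
Proof.
rewrite inE => /eqP r2 ur; rewrite -ltnS -[2]r2 -card_neighbours.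
rewrite (cardsD1 u [set w | adj E r w]) inE adj_sym ur /= add1n ltnS.
apply/subset_leq_card/fintype.subsetP => w; rewrite !inE negb_or.
by move=> /andP[/andP[/andP[-> _] _] ->].
Qed.

Lemma branch_conditionE : branch_condition E U <->
  forall u r, u \in U -> r \in U -> u \in Vdeg E 1 -> r \in Vdeg E 2 -> adj E u r ->
  3 <= \sum_(w in U :\: [set u; r]) (if adj E r w then 1 else minn 2 (free_val E w)).
Proof.
by split=> h u r uU rU u1 r2 ur; apply/branch_choice => //;
  [|exact: branch_neighbours r2 ur|exact: h| |exact: branch_neighbours r2 ur|exact: h];
  move=> w; rewrite !inE => /andP[_ /U_free].
Qed.

Hypothesis U_parity : ~~ odd (\sum_(v in U) free_val E v).

(** The joker contributes one free valency; without any other, the total would be 1, which is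
    odd. *)
Lemma parity_joker : joker_condition E U.
Proof.
move=> v vU v2 _; rewrite lt0n; apply: contraNneq U_parity => h.
move: v2; rewrite -[2]/(3 - 1) -free_valE// => /eqP v1.
rewrite (bigD1 v)//= v1; move: h; rewrite /free_in.
by rewrite (eq_bigl (fun w => (w \in U) && (w != v))) => [->|w]//; rewrite !inE andbC.
Qed.

Hypothesis U_closed : forall v w, v \in U -> deg E v = 1 -> adj E v w ->
  deg E w <= 2 -> w \in U.

(** By the closure hypothesis on [U], the neighbour of a leaf in [U] lies in [U] unless it has
    degree 3. The leaf condition can thus be read off the induced graph. *)
Lemma leaf_hypothesis v : v \in U -> v \in Vdeg E 1 ->
  (exists2 w, adj E v w & deg E w = 3) <-> (forall w, w \in U -> ~~ adj E v w).
Proof.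
move=> vU; rewrite inE => /eqP v1; have := v1; rewrite -card_neighbours => /eqP/cards1P[w nv].
have vw u : adj E v u = (u == w) by have /setP /(_ u) := nv; rewrite !inE.
split=> [[w' + w3] u uU|h].
  rewrite !vw => /eqP ww'; rewrite -ww'; apply: contraTneq (U_free uU) => ->.
  by rewrite /free_val w3.
have vwT : adj E v w by rewrite vw.
exists w => //; apply/eqP; rewrite eqn_leq deg3 /= ltnNge; apply/negP => w2.
by move: (h w (U_closed vU v1 vwT w2)); rewrite vwT.
Qed.

(** Every term is at least 1. A sum of 3 would force three vertices with one free valency each,
    against parity. *)
Lemma parity_minn (S : {set V}) : S \subset U -> 3 <= #|S| ->
  ~~ odd (\sum_(w in S) free_val E w) -> 4 <= \sum_(w in S) minn 2 (free_val E w).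
Proof.
move=> /fintype.subsetP SU S3 Sodd.
have min1 w : w \in S -> 1 <= minn 2 (free_val E w).
  by move=> /SU /U_free ?; rewrite leq_min.
have cardS : #|S| <= \sum_(w in S) minn 2 (free_val E w).
  by rewrite -sum1_card; exact: leq_sum.
rewrite ltnNge; apply: contra Sodd => le3.
have S_eq3 : #|S| = 3 by lia.
suff -> : \sum_(w in S) free_val E w = \sum_(w in S) minn 2 (free_val E w).
  by have -> : \sum_(w in S) minn 2 (free_val E w) = 3 by lia.
apply: eq_bigr => w wS.
have : minn 2 (free_val E w) <= 1.
  have : \sum_(v in S | v != w) 1 <= \sum_(v in S | v != w) minn 2 (free_val E v).
    by apply: leq_sum => v /andP[/min1].
  have := S_eq3; rewrite -sum1_card (bigD1 w)//=; move: le3; rewrite (bigD1 w)//=; lia.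
by rewrite /free_val; lia.
Qed.

Lemma sumU_setD2 (F : V -> nat) u v : u \in U -> v \in U -> u != v ->
  \sum_(w in U) F w = F u + F v + \sum_(w in U :\: [set u; v]) F w.
Proof.
move=> uU vU uv; rewrite (bigD1 u)//= (bigD1 v) ?vU 1?eq_sym//= addnA; congr (_ + _).
by apply: eq_bigl => w; rewrite !inE negb_or; case: (w \in U); rewrite ?andbT ?andbF.
Qed.

Lemma adj_neq u v : adj E u v -> u != v.
Proof. by apply: contraTneq => ->; rewrite adj_irr. Qed.

(** At least 5 - |S| vertices with free valencies remain outside an indicator set S. For sticks,
    pairs of islands and 3-cycles this count is one short, and parity supplies the missing one. *)
Lemma parity_matching : 5 <= #|U| -> matching_condition E U.
Proof.
move=> U5.
have card1 v : v \in U -> #|U| = #|U :\: [set v]| + 1.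
  by move=> vU; rewrite addnC (cardsD1 v) vU.
have card2 u v : u \in U -> v \in U -> u != v -> #|U| = #|U :\: [set u; v]| + 2.
  move=> uU vU uv; have := sumU_setD2 (fun=> 1) uU vU uv; rewrite !sum1_card; lia.
have ge1 (S : {set V}) : S \subset U -> #|S| <= free_in E S.
  move=> /fintype.subsetP SU; rewrite -sum1_card; apply: leq_sum => w /SU; exact: U_free.
have min4 u v : u \in U -> v \in U -> u != v -> ~~ odd (free_val E u + free_val E v) ->
    4 <= \sum_(w in (U :\: [set u; v])%SET) minn 2 (free_val E w).
  move=> uU vU uv uvodd; apply: parity_minn; first exact: finset.subsetDl.
    by have := card2 _ _ uU vU uv; lia.
  by move: U_parity; rewrite (sumU_setD2 _ uU vU uv) oddD (negbTE uvodd).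
have degE k v : k <= 3 -> v \in Vdeg E (3 - k) -> free_val E v = k.
  by move=> k3; rewrite -free_valE// => /eqP.
split; split; [exact: parity_joker|split; [|split]|..|split; [|split]].
- move=> u v uU vU _ _ /adj_neq uv; apply: leq_trans (ge1 _ (finset.subsetDl _ _)).
  by have := card2 _ _ uU vU uv; lia.
- by move=> v vU _ _; rewrite free_vertices1//; lia.
- apply/branch_conditionE => u r uU rU _ _ /adj_neq ur.
  apply: (@leq_trans #|U :\: [set u; r]|); first by have := card2 _ _ uU rU ur; lia.
  rewrite -sum1_card; apply: leq_sum => w; rewrite !inE => /andP[_ /U_free wU].
  by case: ifP => // _; rewrite leq_min.
- by move=> v vU _; rewrite free_vertices1//; lia.
- move=> u v uU vU u1 v1 /adj_neq uv; apply: min4 => //.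
  by rewrite (degE 2 u)// (degE 2 v).
- move=> u v uU vU u1 v1 uv; apply: min4 => //.
  by rewrite (degE 3 u)// (degE 3 v).
- move=> u v w uU vU wU u2 v2 w2 uv vw wu; rewrite /free_in.
  have wS : w \in U :\: [set u; v].
    by rewrite !inE negb_or wU (adj_neq wu) eq_sym (adj_neq vw).
  have := sumU_setD2 (free_val E) uU vU (adj_neq uv).
  rewrite (degE 1 u)// (degE 1 v)// (bigD1 w wS)/= (degE 1 w)//.
  have -> : \sum_(i in U :\: [set u; v] | i != w) free_val E i =
      free_in E (U :\: [set u; v; w]).
    by apply: eq_bigl => i; rewrite !inE !negb_or; case: (i == w); rewrite ?andbF ?andbT.
  move=> S_eq; have := U_parity; rewrite S_eq.
  have : 2 <= free_in E (U :\: [set u; v; w]).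
    apply: leq_trans (ge1 _ (finset.subsetDl _ _)).
    have := card2 _ _ uU vU (adj_neq uv); rewrite (cardsD1 w (U :\: _)) wS.
    have -> : (U :\: [set u; v]) :\ w = U :\: [set u; v; w].
      by apply/setP => i; rewrite !inE !negb_or andbA; case: (i == w); rewrite ?andbF ?andbT.
    lia.
  rewrite /free_in; lia.
Qed.

End Conditions.

(** * The matching condition in terms of indices *)

Section TransferConditions.
Local Open Scope nat_scope.
Variables (V : finType) (E : {set {set V}}) (U : {set V}).
Hypothesis simpleE : simple_graph E.
Hypothesis deg3 : forall v, deg E v <= 3.
Hypothesis U_free : {in U, forall v, 0 < free_val E v}.
Variables (n : nat) (x : nat -> V).
Hypothesis x_inj : {in gtn n &, injective x}.
Hypothesis memU : forall v, (v \in U) = (v \in map x (iota 0 n)).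
Variables (d : seq nat) (h : nat -> nat -> bool).
Hypothesis dE : forall i, i < n -> nth 0 d i = free_val E (x i).
Hypothesis hE : forall i j, i < n -> j < n -> h i j = adj E (x i) (x j).
Hypothesis U_parity : ~~ odd (\sum_(v in U) free_val E v).
Hypothesis U_closed : forall v w, v \in U -> deg E v = 1 -> adj E v w ->
  deg E w <= 2 -> w \in U.

(** Every vertex of [U] has free valencies, so the leaf and island requirements are just lower
    bounds on [n]. The other requirements are sums, transferred by [osumE]. *)
Lemma transfer_conditions :
  matching_condition E U <-> model_conditions n (nth 0 d) h.
Proof.
have cardU : #|U| = n.
  rewrite (eq_card memU) (card_uniqP (map_x_uniq x_inj)).
  by rewrite size_map size_iota.
have degd k i : k <= 3 -> i < n -> (nth 0 d i == k) = (x i \in Vdeg E (3 - k)).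
  by move=> k3 i_n; rewrite dE// free_valE.
have mem2 i j k : i < n -> j < n -> k < n ->
    (x k \in [set x i; x j]) = (k \in [:: i; j]).
  by move=> ? ? ?; rewrite !inE !(eq_x x_inj).
have mem3 i j l k : i < n -> j < n -> l < n -> k < n ->
    (x k \in [set x i; x j; x l]) = (k \in [:: i; j; l]).
  by move=> ? ? ? ?; rewrite !inE !(eq_x x_inj)// orbA.
have osum2 F (G : V -> nat) i j : i < n -> j < n ->
    (forall k, k < n -> F k = G (x k)) ->
    osum n F [:: i; j] = \sum_(v in U :\: [set x i; x j]) G v.
  by move=> i_n jn FG; apply: (osumE x_inj memU) => // k; rewrite inE => kn; exact: mem2.
have sum_d i j : i < n -> j < n ->
    osum n (nth 0 d) [:: i; j] = free_in E (U :\: [set x i; x j]).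
  by move=> i_n jn; exact: osum2.
have sum_min i j : i < n -> j < n ->
    osum n (fun w => minn 2 (nth 0 d w)) [:: i; j] =
    \sum_(v in U :\: [set x i; x j]) minn 2 (free_val E v).
  by move=> i_n jn; apply: osum2 => // k kn; rewrite dE.
have sum_branch i j : i < n -> j < n ->
    osum n (fun w => if h j w then 1 else minn 2 (nth 0 d w)) [:: i; j] =
    \sum_(v in U :\: [set x i; x j]) (if adj E (x j) v then 1 else minn 2 (free_val E v)).
  by move=> i_n jn; apply: osum2 => // k kn; rewrite dE// hE.
have sum_d3 i j k : i < n -> j < n -> k < n ->
    osum n (nth 0 d) [:: i; j; k] = free_in E (U :\: [set x i; x j; x k]).
  by move=> i_n jn kn; apply: (osumE x_inj memU) => // l; rewrite inE => ln; exact: mem3.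
have xU' := xU memU; have Ux' := Ux memU.
have mem_n i : (i \in iota 0 n) = (i < n) by rewrite mem_iota.
have leaf_free i : i < n -> x i \in Vdeg E 1 ->
    (exists2 w, adj E (x i) w & deg E w = 3) <-> ~~ has (h i) (iota 0 n).
  move=> i_n i1.
  have lh := leaf_hypothesis simpleE deg3 U_free U_closed (xU' _ i_n) i1.
  split=> [/lh nadj|/hasPn nadj].
    apply/hasPn => j; rewrite mem_n => jn.
    by rewrite hE// nadj// xU'.
  by apply/lh => w /Ux'[j jn ->]; rewrite -hE// nadj// mem_n.
have bE := branch_conditionE simpleE U_free.
split.
  move=> [[_ [hp [hl /bE hb]]] [hi [hs [ht h3]]]].
  apply/allP => i; rewrite mem_n => i_n; apply/and3P; split.
  - apply/implyP => /andP[]; rewrite degd// => i1 /(leaf_free _ i_n i1) leaf.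
    by have := hl _ (xU' _ i_n) i1 leaf; rewrite free_vertices1 ?xU'// cardU; lia.
  - apply/implyP; rewrite degd// => i0.
    by have := hi _ (xU' _ i_n) i0; rewrite free_vertices1 ?xU'// cardU; lia.
  apply/allP => j; rewrite mem_n => jn; apply/and5P; split.
  - apply/implyP => /and3P[]; rewrite !degd// hE// sum_d//; apply: hp; exact: xU'.
  - apply/implyP => /and3P[]; rewrite !degd// hE// sum_branch//; apply: hb; exact: xU'.
  - apply/implyP => /and3P[]; rewrite !degd// hE// sum_min//; apply: hs; exact: xU'.
  - apply/implyP => /and3P[ij]; rewrite !degd// sum_min// => i0 j0.
    by apply: ht => //; rewrite ?xU' ?(eq_x x_inj).
  apply/allP => k; rewrite mem_n => kn; apply/implyP => /and5P[].
  rewrite !degd// !hE// => i2 j2 k2 ij /andP[jk ki].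
  by rewrite sum_d3//; apply: h3 => //; exact: xU'.
move=> /allP mc.
(* Unpacks the five clauses for a pair of indices from the nested [all]. *)
have pair_of i j : i < n -> j < n -> _ := fun i_n jn =>
  let: And3 _ _ a := and3P (mc i (etrans (mem_n i) i_n)) in
  and5P (allP a j (etrans (mem_n j) jn)).
split; split; [exact: parity_joker|split; [|split]|..|split; [|split]].
- move=> _ _ /Ux'[i i_n ->] /Ux'[j jn ->] i2 j2 ij.
  have [/implyP + _ _ _ _] := pair_of _ _ i_n jn.
  by rewrite !degd// hE// sum_d//; apply; apply/and3P.
- move=> _ /Ux'[i i_n ->] i1 leaf; rewrite free_vertices1 ?xU'// cardU.
  have /and3P[/implyP + _ _] := mc i (etrans (mem_n i) i_n).
  rewrite degd// => /(_ _); have /(leaf_free _ i_n i1) -> := leaf.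
  by rewrite i1 => /(_ isT); lia.
- apply/bE => _ _ /Ux'[i i_n ->] /Ux'[j jn ->] i1 j2 ij.
  have [_ /implyP + _ _ _] := pair_of _ _ i_n jn.
  by rewrite !degd// hE// sum_branch//; apply; apply/and3P.
- move=> _ /Ux'[i i_n ->] i0; rewrite free_vertices1 ?xU'// cardU.
  have /and3P[_ /implyP + _] := mc i (etrans (mem_n i) i_n).
  by rewrite degd// => /(_ i0); lia.
- move=> _ _ /Ux'[i i_n ->] /Ux'[j jn ->] i1 j1 ij.
  have [_ _ /implyP + _ _] := pair_of _ _ i_n jn.
  by rewrite !degd// hE// sum_min//; apply; apply/and3P.
- move=> _ _ /Ux'[i i_n ->] /Ux'[j jn ->] i0 j0 ij.
  have [_ _ _ /implyP + _] := pair_of _ _ i_n jn.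
  rewrite !degd// sum_min//; apply; apply/and3P; split => //.
  by rewrite -(eq_x x_inj).
- move=> _ _ _ /Ux'[i i_n ->] /Ux'[j jn ->] /Ux'[k kn ->] i2 j2 k2 ij jk ki.
  have [_ _ _ _ /allP /(_ k (etrans (mem_n k) kn)) /implyP] := pair_of _ _ i_n jn.
  by rewrite !degd// !hE// sum_d3//; apply; rewrite i2 j2 k2 ij jk ki.
Qed.

End TransferConditions.

(** * Small sets by computation, large sets by induction *)

Section Realizability.
Local Open Scope nat_scope.
Variable V : finType.
Implicit Types (E W : {set {set V}}) (U : {set V}).

Lemma every_modelP n D (P : seq nat -> (nat -> nat -> bool) -> bool) t d :
  every_model n D P -> t \in triangles n -> d \in words D n ->
  admissible n (nth 0 d) (tadj t) -> P d (tadj t).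
Proof.
move=> /allP h /h; case: ifP => [_ /allP + /[swap] adm|/negP h2 _ _ /andP[/allP d0 /allP d3]].
  by move=> dP /dP; rewrite adm.
case: h2; apply/allP => i i_n; have := d0 i i_n; have := d3 i i_n => /=; lia.
Qed.

(** The last clause is where the finite checks enter: whatever was verified for all models holds for
    the model of the given graph. *)
Lemma graph_model E U D : simple_graph E -> (forall v, deg E v <= 3) ->
  {in U, forall v, deg E v <= 2} -> {in U, forall v, free_val E v \in D} ->
  0 < #|U| ->
  exists (x : nat -> V) (d : seq nat) (h : nat -> nat -> bool),
  [/\ {in gtn #|U| &, injective x},
      forall v, (v \in U) = (v \in map x (iota 0 #|U|)),
      size d = #|U| /\ forall i, i < #|U| -> nth 0 d i = free_val E (x i),
      forall i j, i < #|U| -> j < #|U| -> h i j = adj E (x i) (x j) &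
      forall P, every_model #|U| D P -> P d h].
Proof.
move=> simpleE deg3 deg2 UD /card_gt0P[v0 _].
pose x i := nth v0 (enum U) i; pose n := #|U|.
have size_enum : size (enum U) = n by rewrite -cardE.
have xinj : {in gtn n &, injective x}.
  by move=> i j i_n jn /eqP; rewrite nth_uniq ?enum_uniq ?size_enum// => /eqP.
have memU v : (v \in U) = (v \in map x (iota 0 n)).
  by rewrite -size_enum map_nth_iota0// take_size mem_enum.
pose d := mkseq (fun i => free_val E (x i)) n.
pose a i j := adj E (x i) (x j).
pose t := mkseq (fun j => mkseq (fun i => a i j) j) n.
have dE i : i < n -> nth 0 d i = free_val E (x i) by move=> i_n; rewrite nth_mkseq.
have tE i j : i < n -> j < n -> tadj t i j = adj E (x i) (x j).
  move=> i_n jn; rewrite tadj_mkseq//; first by move=> k l; rewrite /a adj_sym.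
  by move=> k; rewrite /a adj_irr.
have size_d : size d = n by rewrite size_mkseq.
exists x, d, (tadj t); split => // P /every_modelP; apply.
- exact: mem_triangles.
- rewrite -/n -size_d; apply: mem_words; apply/(all_nthP 0) => i; rewrite size_d => i_n.
  by rewrite dE// UD// (xU memU).
- by apply: (transfer_admissible simpleE xinj memU) => // v /deg2.
Qed.

(** Double counting: the free valencies are the degrees in [W], and both ends of each edge of [W]
    lie in [U]. *)
Lemma realizable_parity E U :
  realizable_set E U -> parity_condition E U.
Proof.
move=> [W [WU WE Wd]]; rewrite /parity_condition.
have -> : \sum_(v in U) free_val E v = \sum_(e in W) 2.
  transitivity (\sum_(v in U) \sum_(e in W) (v \in e : nat)).
    apply: eq_bigr => v vU; rewrite /free_val -(Wd _ vU) degU// addKn /deg.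
    by rewrite -sum1_card -big_mkcondr /=; apply: eq_bigl => e; rewrite inE.
  rewrite exchange_big /=; apply: eq_bigr => e eW; have [eU e2] := WU _ eW.
  rewrite -e2 -sum1_card -big_mkcondr /=; apply: eq_bigl => v.
  by case: (boolP (v \in e)) => [/(fintype.subsetP eU) ->|]; rewrite ?andbF.
by rewrite sum_nat_const muln2 odd_double.
Qed.

Lemma realizable5 E U : simple_graph E -> (forall v, deg E v <= 3) ->
  {in U, forall v, deg E v <= 2} -> #|U| = 5 -> parity_condition E U ->
  realizable_set E U.
Proof.
move=> simpleE deg3 deg2 U5 par.
have UD : {in U, forall v, free_val E v \in [:: 1; 2; 3]}.
  by move=> v /deg2; rewrite /free_val !inE; lia.
have [|x [d [h [xinj memU [size_d dE] hE mP]]]] := graph_model simpleE deg3 deg2 UD.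
  by rewrite U5.
apply/(realizable_search xinj memU size_d dE hE deg3).
move: mP; rewrite U5 => /(_ _ five_models).
by rewrite (sumn_d xinj memU size_d dE) (negbTE par).
Qed.

Lemma realizable6 E U : simple_graph E -> (forall v, deg E v <= 3) ->
  {in U, forall v, free_val E v = 1} -> #|U| = 6 -> realizable_set E U.
Proof.
move=> simpleE deg3 free1 U6.
have deg2 : {in U, forall v, deg E v <= 2} by move=> v /free1; rewrite /free_val; lia.
have UD : {in U, forall v, free_val E v \in [:: 1]} by move=> v /free1 ->.
have [|x [d [h [xinj memU [size_d dE] hE mP]]]] := graph_model simpleE deg3 deg2 UD.
  by rewrite U6.
apply/(realizable_search xinj memU size_d dE hE deg3).
by move: mP; rewrite U6 => /(_ _ six_models).
Qed.

Lemma degU1 E a b v : ~~ adj E a b ->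
  deg ([set a; b] |: E) v = deg E v + ((v == a) || (v == b)).
Proof.
move=> nab; rewrite finset.setUC degU; last first.
  by move=> e; rewrite inE => /eqP ->.
congr (_ + _); rewrite /deg; case: (boolP (_ || _)) => vab.
  transitivity #|[set [set a; b]]|; last by rewrite cards1.
  apply: eq_card => e; rewrite !inE.
  by case: eqP => //= ->; rewrite !inE.
by apply: eq_card0 => e; rewrite !inE; case: eqP => //= ->; rewrite !inE (negbTE vab).
Qed.

(** Vertices saturated by the new edge leave the set; the remaining [W] does not touch them. *)
Lemma realizable_add_edge E U a b : a \in U -> b \in U -> a != b -> ~~ adj E a b ->
  (forall v, deg ([set a; b] |: E) v <= 3) ->
  realizable_set ([set a; b] |: E) [set v in U | deg ([set a; b] |: E) v <= 2] ->
  realizable_set E U.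
Proof.
set E' := [set a; b] |: E; set U' := [set v in U | _].
move=> aU bU ab nab deg3 [W [WU WE Wd]].
exists ([set a; b] |: W); split.
- move=> e; rewrite !inE => /orP[/eqP ->|/WU[eU' e2]].
    rewrite cards2 ab; split => //; apply/fintype.subsetP => v.
    by rewrite !inE => /orP[]/eqP ->.
  split => //; apply: fintype.subset_trans eU' _.
  by apply/fintype.subsetP => v; rewrite inE => /andP[].
- move=> e; rewrite !inE => /orP[/eqP -> //|/WE].
  by rewrite !inE negb_or => /andP[].
move=> v vU; have -> : E :|: ([set a; b] |: W) = E' :|: W.
  by rewrite /E' finset.setUCA finset.setUA.
have [v2|v3] := leqP (deg E' v) 2; first by apply: Wd; rewrite inE vU.
rewrite degU//; have -> : deg W v = 0.
  apply: eq_card0 => e; rewrite !inE; apply/negP => /andP[eW ve].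
  have [/fintype.subsetP eU' _] := WU _ eW.
  by have := eU' _ ve; rewrite inE leqNgt v3 andbF.
by rewrite addn0; apply/eqP; rewrite eqn_leq deg3.
Qed.

Lemma realizable_large E U : simple_graph E -> (forall v, deg E v <= 3) ->
  {in U, forall v, deg E v <= 2} -> 5 <= #|U| -> parity_condition E U ->
  realizable_set E U.
Proof.
have [m] := ubnP (\sum_(v in U) free_val E v).
elim: m E U => // m IH E U; rewrite ltnS => sum_m simpleE deg3 deg2 U5 par.
have [U_eq5|U_neq5] := eqVneq #|U| 5; first exact: realizable5.
have U6 : 6 <= #|U| by rewrite ltn_neqAle eq_sym U_neq5.
have free1 v : v \in U -> 0 < free_val E v.
  by move=> /deg2; rewrite /free_val; lia.
(* The new edge may saturate both of its ends. At least five vertices remain if there were seven, or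
   if there were six and [a] keeps a free valency. *)
have [|[a aU a_ok]] : {in U, forall v, free_val E v = 1} /\ #|U| = 6 \/
    exists2 a, a \in U & (7 <= #|U|) || (2 <= free_val E a).
- have [U7|U7] := leqP 7 #|U|.
    have /card_gt0P[a aU] : 0 < #|U| by lia.
    by right; exists a.
  have [/exists_inP[a aU a2]|/exists_inPn all1] :=
      boolP [exists a in U, 2 <= free_val E a].
    by right; exists a => //; rewrite a2 orbT.
  left; split; last by lia.
  by move=> v vU; have := all1 v vU; have := free1 v vU; lia.
- by case=> ? ?; exact: realizable6.
(* At least five candidates for [b] exist, and at most three of them are neighbours of [a]. *)
have [b bU /andP[ab nab]] : exists2 b, b \in U & (a != b) && ~~ adj E a b.
  apply/exists_inP; rewrite -[X in is_true X]negbK; apply/negP => /exists_inPn h.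
  have : U :\ a \subset [set w | adj E a w].
    apply/fintype.subsetP => w; rewrite !inE => /andP[wa wU].
    by have := h w wU; rewrite eq_sym wa /= negbK.
  move=> /subset_leq_card; rewrite card_neighbours//.
  have := cardsD1 a U; rewrite aU; have := deg3 a; lia.
pose E' := [set a; b] |: E; pose U' := [set v in U | deg E' v <= 2].
have deg3' v : deg E' v <= 3.
  rewrite degU1//; have := deg3 v.
  by case: eqP => [->|_]; [have := deg2 _ aU|case: eqP => [->|_]; [have := deg2 _ bU|]]; lia.
have free_E' v : v \in U -> free_val E' v + ((v == a) || (v == b)) = free_val E v.
  by move=> vU; have := deg2 _ vU; rewrite /free_val degU1//; case: (_ || _); lia.
(* The total drops by exactly 2, which preserves parity and makes the induction progress; the
   vertices that left the set contribute 0. *)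
have sum' : \sum_(v in U') free_val E' v + 2 = \sum_(v in U) free_val E v.
  rewrite -(eq_bigr _ free_E') big_split /=; congr (_ + _).
    rewrite [RHS](bigID (fun v => deg E' v <= 2)) /= [X in _ + X]big1 ?addn0.
      by apply: eq_bigl => v; rewrite inE.
    by move=> v /andP[_]; rewrite /free_val; lia.
  rewrite -big_mkcondr /=; transitivity #|[set a; b]|; first by rewrite cards2 ab.
  rewrite -sum1_card; apply: eq_bigl => v; rewrite !inE.
  by case: eqP => [->|_] /=; [rewrite aU|case: eqP => [->|_]; rewrite ?bU ?andbF].
apply: (realizable_add_edge aU bU ab nab deg3'); rewrite -/E' -/U'; apply: IH.
- by move: sum_m; rewrite -sum' addn2; lia.
- by move=> e; rewrite !inE => /orP[/eqP ->|/simpleE//]; rewrite cards2 ab.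
- exact: deg3'.
- by move=> v; rewrite inE => /andP[].
- have sub : U :\ a :\ b \subset U'.
    apply/fintype.subsetP => v; rewrite !inE => /and3P[vb va vU]; rewrite vU /=.
    by rewrite degU1// (negbTE va) (negbTE vb) addn0 deg2.
  have cab : #|U| = #|U :\ a :\ b| + 2.
    by rewrite (cardsD1 a U) aU (cardsD1 b (U :\ a)) !inE eq_sym ab bU; lia.
  case/orP: a_ok => [U7|a2]; first by have := subset_leq_card sub; lia.
  have aU' : a \in U'.
    by rewrite inE aU /= degU1// eqxx /=; move: a2; rewrite /free_val; lia.
  have : a |: (U :\ a :\ b) \subset U' by rewrite finset.subUset finset.sub1set aU' sub.
  by move=> /subset_leq_card; rewrite cardsU1 !inE eqxx andbF /=; lia.
- by move: par; rewrite /parity_condition -sum' oddD addbF.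
Qed.

Lemma realizable_small E U : simple_graph E -> (forall v, deg E v <= 3) ->
  {in U, forall v, deg E v <= 2} ->
  (forall v w, v \in U -> deg E v = 1 -> adj E v w -> deg E w <= 2 -> w \in U) ->
  #|U| <= 4 -> parity_condition E U -> realizable_set E U <-> matching_condition E U.
Proof.
move=> simpleE deg3 deg2 closedU U4 par.
have U_free : {in U, forall v, 0 < free_val E v}.
  by move=> v /deg2; rewrite /free_val; lia.
have UD : {in U, forall v, free_val E v \in [:: 1; 2; 3]}.
  by move=> v /deg2; rewrite /free_val !inE; lia.
(* The empty set is treated apart, since the enumeration of [U] takes a default vertex from it. *)
have [U0|Upos] := posnP #|U|.
  have nU v : v \in U -> False by move=> vU; move: U0; rewrite (cardsD1 v) vU.
  split=> _; last first.
    by exists finset.set0; split => [e|e|v /nU//]; rewrite inE.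
  split; split; [|split; [|split]| |split; [|split]];
    by [move=> v /nU|move=> u v /nU|move=> u v w /nU].
have [x [d [h [xinj memU [size_d dE] hE mP]]]] := graph_model simpleE deg3 deg2 UD Upos.
have small : small_model #|U| by apply: (allP small_models); rewrite mem_iota.
have rs := realizable_search xinj memU size_d dE hE deg3.
have tc := transfer_conditions simpleE deg3 U_free xinj memU dE hE par closedU.
have := mP _ small; rewrite (sumn_d xinj memU size_d dE) par /= => /eqP e.
by split=> [/rs|/tc]; [rewrite e => /tc|rewrite -e => /rs].
Qed.

End Realizability.

Theorem theorem2 (R : realType) (V : finType) (E : {set {set V}})
    (simpleE : simple_graph E)
    (max_degree3 : forall v : V, (deg E v <= 3)%N)
    (G : planar_embedding R E)
    (A : V -> set (R * R)%type) (hA : node_assignment G A)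
    (f : set (R * R)%type) (hf : is_face G f) :
  realizable_for E A f <-> satisfies_parity E A f /\ satisfies_matching E A f.
Proof.
rewrite /realizable_for /satisfies_parity /satisfies_matching.
set U := assigned E A f.
have UP v : (v \in U) = (v \in Vbar E) && `[< A v = f >] by rewrite !inE.
have VbarE v : (v \in Vbar E) = (deg E v <= 2)%N by rewrite !inE; lia.
have deg2 : {in U, forall v, (deg E v <= 2)%N}.
  by move=> v; rewrite UP VbarE => /andP[].
(* The geometry enters here: the leaf [v] and its neighbour [w] can only be assigned to the same
   face. *)
have closedU v w : v \in U -> deg E v = 1%N -> adj E v w ->
    (deg E w <= 2)%N -> w \in U.
  rewrite !UP => /andP[/hA[fAv vAv] /asboolP Avf] v1 vw w2.
  have wV : w \in Vbar E by rewrite VbarE.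
  have [fAw wAw] := hA w wV.
  rewrite wV; apply/asboolP; rewrite -Avf.
  exact/esym/(leaf_neighbour_face simpleE vw v1 w2 fAv fAw vAv wAw).
have U_free : {in U, forall v, (0 < free_val E v)%N}.
  by move=> v /deg2; rewrite /free_val; lia.
have real_par := @realizable_parity V E U.
have [U4|U5] := leqP #|U| 4.
  have small := realizable_small simpleE max_degree3 deg2 closedU U4.
  by split=> [r|[par m]]; [split; [|apply/small]|apply/small] => //; exact: real_par.
split=> [r|[par _]]; last exact: realizable_large.
have par := real_par r; split => //.
exact: parity_matching.
Qed.
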